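(* Let $\mu$ be doubling and let $X$ be a quasi-Banach function lattice over $(\mathcal P,\mu)$. Suppose that $\mathcal P$ supports a $p$-Poincaré inequality with dilation constant $\lambda\ge1$, where $1\le p<s$ and $s$ is such that the dimension condition holds with exponent $s$. Assume that $X\hookrightarrow L^{s,1}_{\mathrm{loc}}$. Then there is a constant $C>0$ such that the following holds for every fixed ball $B_0\subset\mathcal P$ of radius $R>0$. There is a constant $c_{B_0}>0$ such that for every ball $B\subset B_0$ of radius $r\in(0,R)$, $$C_X\text{-}\operatorname*{ess\,sup}_{x\in B}|u(x)-u_B|\le C\,\frac{c_{\mathrm{emb}}(2\lambda B)\,r}{\mu(2\lambda B)^{1/s}}\,\|g\chi_{2\lambda B}\|_X \quad\text{and}\quad \frac{c_{\mathrm{emb}}(2\lambda B)\,r}{\mu(2\lambda B)^{1/s}}\,\|g\chi_{2\lambda B}\|_X\le c_{B_0}\,\|g\chi_{2\lambda B}\|_X$$ whenever $g\in X$ is an $X$-weak upper gradient of $u\in N^1X$. Moreover, $c_{B_0}$ can be chosen with $$C^{-1}K\le c_{B_0}\le CK,\qquad K=\frac{c_{\mathrm{emb}}(2\lambda B_0)\,R}{\mu(2\lambda B_0)^{1/s}}.$$ The constant $C$ is independent of $B_0$, $R$, $B$, $r$, $u$ and $g$.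
   Context: Setting. $\mathcal P=(\mathcal P,\mathrm d,\mu)$ is a metric space with a $\sigma$-finite Borel regular measure $\mu$ (all Borel sets are $\mu$-measurable, and every $\mu$-measurable set $A$ is contained in a Borel set $D$ with $\mu(D)=\mu(A)$) such that every ball has finite positive measure. A ball $B=B(x,r)$ is open and comes with its center and radius; $\lambda B=B(x,\lambda r)$. $u_B=\mu(B)^{-1}\int_Bu\,d\mu$. $\mathcal M(\mathcal P,\mu)$ is the set of all extended real-valued $\mu$-measurable functions on $\mathcal P$ (defined everywhere). Quasi-Banach function lattice: a linear space $X=\{u\in\mathcal M(\mathcal P,\mu):\|u\|_X<\infty\}$ given by a functional $\|\cdot\|_X:\mathcal M(\mathcal P,\mu)\to[0,\infty]$ such that: $\|u\|_X=0$ iff $u=0$ a.e.; $\|au\|_X=|a|\,\|u\|_X$ for $a\in\mathbb R$; there is a constant $c_\triangle\ge1$ with $\|u+v\|_X\le c_\triangle(\|u\|_X+\|v\|_X)$; if $|u|\le|v|$ a.e. then $\|u\|_X\le\|v\|_X$; and (Riesz--Fischer) if $u_n\ge0$ a.e. for all $n$ then $\|\sum_{n=1}^\infty u_n\|_X\le\sum_{n=1}^\infty c_\triangle^n\|u_n\|_X$. The quasi-norm is also assumed continuous: $\|u_n-u\|_X\to0$ implies $\|u_n\|_X\to\|u\|_X$. Newtonian space. A curve is a non-constant continuous map $\gamma$ from a compact interval into $\mathcal P$ of finite length, parametrized by arc length $ds$ on $[0,l_\gamma]$. A Borel function $g:\mathcal P\to[0,\infty]$ is an upper gradient of $u:\mathcal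 P\to[-\infty,\infty]$ if $|u(\gamma(0))-u(\gamma(l_\gamma))|\le\int_\gamma g\,ds$ for every curve $\gamma$, with the convention $|(\pm\infty)-(\pm\infty)|=\infty$. A measurable $g:\mathcal P\to[0,\infty]$ is an $X$-weak upper gradient of $u$ if this inequality holds for $\mathrm{Mod}_X$-a.e. curve, i.e. for all curves except a family $\Gamma_e$ for which there is a nonnegative Borel function $\rho\in X$ with $\int_\gamma\rho\,ds=\infty$ for all $\gamma\in\Gamma_e$. Set $\|u\|_{N^1X}=\|u\|_X+\inf_g\|g\|_X$, infimum over all upper gradients $g$ of $u$, and $N^1X=\{u\in\mathcal M(\mathcal P,\mu):\|u\|_{N^1X}<\infty\}$. Capacity. $C_X(E)=\inf\{\|u\|_{N^1X}:u\ge1\text{ on }E\}$. $C_X\text{-}\operatorname{ess\,sup}_{x\in B}f(x)$ is the infimum of all $a$ such that $C_X(\{x\in B:f(x)>a\})=0$. Doubling: there is $c_{\mathrm{dbl}}\ge1$ with $\mu(2B)\le c_{\mathrm{dbl}}\mu(B)$ for every ball $B$. Dimension condition with exponent $s>0$: there is $c_s>0$ with $\mu(B(y,r))/\mu(B(x,R))\ge c_s(r/R)^s$ whenever $0<r\le R$, $x\in\mathcal P$, $y\in B(x,R)$. $p$-Poincaré inequality ($p\in[1,\infty)$): there are $c_{\mathrm{PI}}>0$ and $\lambda\ge1$ such that $\frac1{\mu(B)}\int_B|u-u_B|\,d\mu\le c_{\mathrm{PI}}\,\mathrm{diam}(B)\bigl(\frac1{\mu(\lambda B)}\int_{\lambda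 B}g^p\,d\mu\bigr)^{1/p}$ for all balls $B$, all $u\in L^1_{\mathrm{loc}}(\mathcal P)$ and all upper gradients $g$ of $u$. Lorentz spaces. The decreasing rearrangement is $f^*(t)=\inf\{\tau\ge0:\mu(\{|f|>\tau\})\le t\}$, and for $1\le q<\infty$, $\|u\|_{L^{q,1}(\mathcal P)}=\frac1q\int_0^\infty u^*(t)t^{1/q-1}\,dt$. Embedding $X\hookrightarrow L^{s,1}_{\mathrm{loc}}$: for every ball $B$ there is a constant $c_{\mathrm{emb}}(B)>0$ with $\|u\chi_B\|_{L^{s,1}(\mathcal P)}\le c_{\mathrm{emb}}(B)\|u\chi_B\|_X$ for all $u\in\mathcal M(\mathcal P,\mu)$; $c_{\mathrm{emb}}(B)$ denotes the smallest such constant.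
   Formalization: In the ''Moreover'' part, the second inequality with C⁻¹K ≤ c_{B₀} ≤ CK is proved for balls B ⊂ B₀ that also satisfy 2λB ⊂ 2λB₀; in a general metric space this does not follow from B ⊂ B₀, r < R, and without it the two-sided bound on c_{B₀} is false. *)

(* Defs.v *)
From HB Require Import structures.
From mathcomp Require Import all_boot all_order all_algebra.
From mathcomp Require Import all_classical all_reals all_analysis.
From mathcomp Require Import measurable_realfun.

Set Implicit Arguments.
Unset Strict Implicit.
Unset Printing Implicit Defensive.

Import Order.TTheory GRing.Theory Num.Theory.
Import numFieldNormedType.Exports.

Local Open Scope classical_set_scope.
Local Open Scope ring_scope.

(* A metric space together with a sigma-algebra (the mu-measurable sets).  No
   compatibility is built in; see [borel_regular_measure]. *)
#[short(type="metricMeasurableType")]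
HB.structure Definition MetricMeasurable (R : realType) (d : measure_display) :=
  {T of Metric R T & Measurable d T}.

(* Throughout, a ball is given by its center x and radius r > 0: it is the open
   set [ball x r], and its dilation by lam is [ball x (lam * r)]. *)

Section MetricSpace.
Context {R : realType}.

Section Curves.
Context {T : metricType R}.
Local Open Scope ereal_scope.

Definition diam (A : set T) : \bar R :=
  ereal_sup [set (mdist yz.1 yz.2)%:E | yz in A `*` A].

(* Metric analogues of [variation] and [total_variation]. *)
Definition polygonal_length (a b : R) (f : R -> T) (l : seq R) : R :=
  let F := f \o nth b (a :: l) in (\sum_(0 <= n < size l) mdist (F n.+1) (F n))%R.

Definition path_length (a b : R) (f : R -> T) : \bar R :=
  ereal_sup [set (polygonal_length a b f l)%:E | l in itv_partition a b].

(* A non-constant continuous curve of finite length, parametrized by arc length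
   on [0, curve_len].  Being non-constant is equivalent to 0 < curve_len, and
   the values of [curve_fun] outside [0, curve_len] are never used. *)
Record curve := Curve {
  curve_len : R ;
  curve_fun :> R -> T ;
  curve_len_gt0 : (0 < curve_len)%R ;
  curve_continuous : {within `[0%R, curve_len], continuous curve_fun} ;
  curve_arclength : forall a b : R, (0 <= a)%R -> (a <= b)%R ->
    (b <= curve_len)%R -> path_length a b curve_fun = (b - a)%:E }.

(* For g >= 0 the library integral is the supremum over Borel simple functions
   below the integrand.  It is the Lebesgue integral when g \o gamma is Lebesgue
   measurable; for g mu-measurable (not Borel) this is the case on Mod-almost
   every curve, and on the others the value is irrelevant. *)
Definition line_integral (gamma : curve) (g : T -> \bar R) : \bar R :=
  \int[lebesgue_measure]_(t in `[0%R, curve_len gamma]) g (gamma t).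

(* In \bar R one has `|x - y| = +oo as soon as x or y is infinite, so that the
   convention |(+-oo) - (+-oo)| = +oo is automatic. *)
Definition upper_gradient_on (u g : T -> \bar R) (gamma : curve) : Prop :=
  `|u (gamma 0%R) - u (gamma (curve_len gamma))| <= line_integral gamma g.

End Curves.

Section Spaces.
Context {d : measure_display} {T : metricMeasurableType R d}.
Variable mu : {measure set T -> \bar R}.
Local Open Scope ereal_scope.

Definition borel_set (A : set T) : Prop := <<s @open T >> A.

Definition borel_fun (g : T -> \bar R) : Prop :=
  measurable_fun setT (g : g_sigma_algebraType (@open T) -> \bar R).

Definition borel_regular_measure : Prop :=
  [/\ sigma_finite setT mu,
      borel_set `<=` measurable,
      (forall A : set T, measurable A ->
         exists D : set T, [/\ borel_set D, A `<=` D & mu D = mu A])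
    & forall (x : T) (r : R), (0 < r)%R -> 0 < mu (ball x r) < +oo].

Definition doubling : Prop :=
  exists2 c : R, (1 <= c)%R &
    forall (x : T) (r : R), (0 < r)%R ->
      mu (ball x (2 * r)) <= c%:E * mu (ball x r).

Definition dimension_condition (s : R) : Prop :=
  exists2 c : R, (0 < c)%R &
    forall (x y : T) (r rho : R), (0 < r)%R -> (r <= rho)%R -> ball x rho y ->
      (c * (r / rho) `^ s)%:E <= mu (ball y r) / mu (ball x rho).

Definition average (A : set T) (u : T -> \bar R) : \bar R :=
  (mu A)^-1 * \int[mu]_(x in A) u x.

(* As for the embedding of X below, locality means on every ball; this makes
   [average (ball x r) u] finite. *)
Definition L1loc (u : T -> \bar R) : Prop :=
  measurable_fun setT u /\
  forall (x : T) (r : R), (0 < r)%R -> mu.-integrable (ball x r) u.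

Definition upper_gradient (u g : T -> \bar R) : Prop :=
  [/\ borel_fun g, (forall x, 0 <= g x)
    & forall gamma : @curve T, upper_gradient_on u g gamma].

Definition poincare (p lam : R) : Prop :=
  exists2 c : R, (0 < c)%R &
    forall (x : T) (r : R) (u g : T -> \bar R), (0 < r)%R ->
      L1loc u -> upper_gradient u g ->
      average (ball x r) (fun y => `|u y - average (ball x r) u|)
        <= c%:E * diam (ball x r) *
           poweR (average (ball x (lam * r)) (fun y => poweR (g y) p)) p^-1.

(* The functional nX is only constrained on, and only applied to, measurable
   functions.  The value given to (+oo) + (-oo) is irrelevant: the axioms force
   functions of finite quasi-norm to be finite almost everywhere. *)
Record quasi_banach_function_lattice (nX : (T -> \bar R) -> \bar R) : Prop := {
  qnorm_ge0 : forall u : T -> \bar R, measurable_fun setT u -> 0 <= nX u ;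
  qnorm_eq0 : forall u : T -> \bar R, measurable_fun setT u ->
    (nX u = 0 <-> {ae mu, forall x, u x = 0}) ;
  qnormZ : forall (a : R) (u : T -> \bar R), measurable_fun setT u ->
    nX (fun x => a%:E * u x) = `|a|%:E * nX u ;
  qnorm_lattice : forall u v : T -> \bar R,
    measurable_fun setT u -> measurable_fun setT v ->
    {ae mu, forall x, `|u x| <= `|v x|} -> nX u <= nX v ;
  qnorm_triangle_riesz_fischer : exists c : R, [/\ (1 <= c)%R,
    (forall u v : T -> \bar R,
       measurable_fun setT u -> measurable_fun setT v ->
       nX (fun x => u x + v x) <= c%:E * (nX u + nX v))
    & forall u : nat -> T -> \bar R,
       (forall n, measurable_fun setT (u n)) ->
       (forall n, {ae mu, forall x, 0 <= u n x}) ->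
       nX (fun x => \sum_(1 <= n <oo) u n x)
         <= \sum_(1 <= n <oo) ((c ^+ n)%:E * nX (u n))] ;
  qnorm_continuous : forall (u_ : nat -> T -> \bar R) (u : T -> \bar R),
    (forall n, measurable_fun setT (u_ n)) -> measurable_fun setT u ->
    nX (fun x => u_ n x - u x) @[n --> \oo] --> 0 ->
    nX (u_ n) @[n --> \oo] --> nX u }.

Definition rearrangement (f : T -> \bar R) (t : R) : \bar R :=
  ereal_inf [set tau%:E | tau in
    [set tau : R | (0 <= tau)%R /\ mu [set x | tau%:E < `|f x|] <= t%:E]].

Definition lorentz_norm (q : R) (f : T -> \bar R) : \bar R :=
  (q^-1)%:E * \int[lebesgue_measure]_(t in `]0%R, +oo[)
                 (rearrangement f t * (t `^ (q^-1 - 1))%:E).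

Section Newtonian.
Variable nX : (T -> \bar R) -> \bar R.

Definition in_X (u : T -> \bar R) : Prop :=
  measurable_fun setT u /\ nX u < +oo.

Definition mod_null (Gamma : set (@curve T)) : Prop :=
  exists rho : T -> \bar R,
    [/\ borel_fun rho, (forall x, 0 <= rho x), in_X rho
      & forall gamma, Gamma gamma -> line_integral gamma rho = +oo].

Definition weak_upper_gradient (u g : T -> \bar R) : Prop :=
  [/\ measurable_fun setT g, (forall x, 0 <= g x)
    & mod_null [set gamma | ~ upper_gradient_on u g gamma]].

Definition N1norm (u : T -> \bar R) : \bar R :=
  nX u + ereal_inf [set nX g | g in upper_gradient u].

Definition in_N1 (u : T -> \bar R) : Prop :=
  measurable_fun setT u /\ N1norm u < +oo.

Definition capacity (E : set T) : \bar R :=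
  ereal_inf [set N1norm u | u in
    [set u | measurable_fun setT u /\ forall x, E x -> 1 <= u x]].

Definition cap_ess_sup (B : set T) (f : T -> \bar R) : \bar R :=
  ereal_inf [set a%:E | a in
    [set a : R | capacity (B `&` [set x | a%:E < f x]) = 0]].

Definition embedding_constant (s : R) (B : set T) (c : R) : Prop :=
  (0 < c)%R /\
  forall u : T -> \bar R, measurable_fun setT u ->
    lorentz_norm s (u \_ B) <= c%:E * nX (u \_ B).

(* X embeds into L^{s,1}_loc, and cemb x r is the smallest embedding constant of
   the ball B(x, r).  The infimum of the embedding constants is attained unless
   it is 0, i.e. unless every u in X vanishes a.e. on the ball. *)
Definition embeds_Lorentz_loc (s : R) (cemb : T -> R -> R) : Prop :=
  forall (x : T) (r : R), (0 < r)%R ->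
    embedding_constant s (ball x r) (cemb x r) /\
    forall c : R, embedding_constant s (ball x r) c -> (cemb x r <= c)%R.

End Newtonian.

(* For B = B(x, r): cemb(2 lam B) * r / mu(2 lam B)^{1/s}. *)
Definition ball_factor (s lam : R) (cemb : T -> R -> R) (x : T) (r : R) : R :=
  (cemb x (2 * lam * r) * r / fine (mu (ball x (2 * lam * r))) `^ s^-1)%R.

End Spaces.
End MetricSpace.

(* Main.v *)
(* Let B = B(x, r) and V = mu(2 lam B), and let G be an upper gradient of u with
   G in X.  Put m_i = c_s V 2^{-is} and write g_i for the decreasing
   rearrangement of G 1_{2 lam B} at m_i.  By the dimension condition the ball
   lam B(y, 2^{1-i} r), for y in B, has measure at least m_i, so that the L^p
   average of G over it is controlled by the g_j with j >= i; since p < s, these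
   bounds, weighted by 2^{-i}, are summable with sum at most a constant times
   sum_i 2^{-i} g_i, and hence V^{-1/s} times the L^{s,1} norm.  Through the
   Poincare inequality this bounds all the averages of |u - u_B| over
   the balls B(y, 2^{-i} r), uniformly in y and i, and makes the mean oscillation
   of u on these balls small for suitable i.  Covering B by a finite net of such
   balls and using Chebyshev's inequality, one gets |u - u_B| <= K a.e. on B
   without any differentiation theorem.

   A weak upper gradient is reduced to genuine ones by a Borel majorant g' and
   the perturbations g' + rho / n, by continuity of the quasi-norm.  Finally, if
   E, the set where |u - u_B| > K in B, is null, and N is a Borel null set
   containing E, then G + oo 1_N has infinite integral along every curve with an
   end point in E: otherwise u would be continuous along the curve at this end
   point, and |u - u_B| <= K at almost all nearby times.  Small multiples of
   G + oo 1_N are thus upper gradients of 1_E, and E has capacity zero. *)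
Require Import Defs.
From HB Require Import structures.
From mathcomp Require Import all_boot all_order all_algebra.
From mathcomp Require Import all_classical all_reals all_analysis.
From mathcomp Require Import measurable_realfun ring lra.

Set Implicit Arguments.
Unset Strict Implicit.
Unset Printing Implicit Defensive.

Import Order.TTheory GRing.Theory Num.Theory.
Import numFieldNormedType.Exports.

Local Open Scope classical_set_scope.
Local Open Scope ring_scope.

(** * Decreasing rearrangement and Lorentz norm *)

Lemma powR_exprAC (R : realType) (a s : R) (n : nat) : 0 <= a ->
  (a ^+ n) `^ s = (a `^ s) ^+ n.
Proof.
move=> a0; elim: n => [|n IH]; first by rewrite !expr0 powR1.
by rewrite !exprS powRM ?exprn_ge0// IH.
Qed.

Lemma powR2N_lt1 (R : realType) (s : R) : 0 < s -> 2 `^ (- s) < 1.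
Proof.
move=> s0; rewrite powRN invf_lt1 ?powR_gt0//.
by have := @gt0_ltr_powR R s s0 1 2; rewrite powR1; apply; rewrite ?nnegrE ?ltr1n.
Qed.

(** The integral of a non-negative function is a supremum over the simple functions below it. This
    form applies to [g \o gamma] for [g] merely [mu]-measurable. *)
Lemma le_nonneg_integral d (T : measurableType d) (R : realType)
    (mu : {measure set T -> \bar R}) (D : set T) (f g : T -> \bar R) :
  (forall x, D x -> 0 <= f x)%E -> (forall x, D x -> f x <= g x)%E ->
  (\int[mu]_(x in D) f x <= \int[mu]_(x in D) g x)%E.
Proof.
move=> f0 fg; have g0 x : D x -> (0 <= g x)%E.
  by move=> Dx; exact: le_trans (f0 _ Dx) (fg _ Dx).
rewrite !ge0_integralE//; apply: le_ereal_sup; apply: image_subset => h /= hf x.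
apply: le_trans (hf x) _.
by rewrite !patchE; case: ifPn => // /set_mem; exact: fg.
Qed.

Lemma measurable_superlevel d (T : measurableType d) (R : realType)
    (f : T -> \bar R) (a : \bar R) :
  measurable_fun setT f -> measurable [set x | (a < f x)%E].
Proof.
move=> mf; rewrite -[X in measurable X]setTI.
exact: emeasurable_fun_o_infty.
Qed.

Section rearrangement.
Context {R : realType} {d : measure_display} {T : metricMeasurableType R d}.
Variable mu : {measure set T -> \bar R}.
Local Open Scope ereal_scope.

Lemma rearrangement_ge0 (f : T -> \bar R) (t : R) : 0 <= rearrangement mu f t.
Proof. by apply: le_ereal_inf_tmp => _ [tau [tau0 _] <-]; rewrite lee_fin. Qed.

Lemma le_rearrangement (f : T -> \bar R) (t t' : R) : (t <= t')%R ->
  rearrangement mu f t' <= rearrangement mu f t.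
Proof.
move=> tt'; apply: ereal_inf_le_tmp; apply: image_subset => tau [tau0 h].
by split => //; apply: le_trans h _; rewrite lee_fin.
Qed.

(** The set is the increasing union of the [F n], and each [F n] has measure at most [t] because its
    level lies strictly above the infimum; continuity from below concludes. *)
Lemma rearrangement_superlevel (f : T -> \bar R) (t a : R) :
  measurable_fun setT f -> rearrangement mu f t <= a%:E ->
  mu [set x | a%:E < `|f x|] <= t%:E.
Proof.
move=> mf fta.
have mF b : measurable [set x | b < `|f x|].
  by apply: measurable_superlevel; exact: measurableT_comp.
pose F n := [set x | (a + n.+1%:R^-1)%:E < `|f x|].
have -> : [set x | a%:E < `|f x|] = \bigcup_n F n.
  apply/seteqP; split => x /=; last first.
    move=> [n _]; apply: le_lt_trans.
    by rewrite lee_fin lerDl invr_ge0.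
  suff H (y : \bar R) : a%:E < y -> exists n : nat, (a + n.+1%:R^-1)%:E < y.
    by move=> /H[n hn]; exists n.
  case: y => [r|_|//]; last by exists 0%N; rewrite ltry.
  rewrite lte_fin -subr_gt0 => ra.
  have [n _ /(_ _ (leqnn n)) hn] := near_infty_natSinv_lt (PosNum ra).
  by exists n; rewrite lte_fin -ltrBrDl.
have ndF : nondecreasing_seq F.
  move=> n m nm; apply/subsetPset => x; apply: le_lt_trans.
  by rewrite lee_fin lerD2l lef_pV2 ?posrE// ler_nat.
have mFn n : measurable (F n) by exact: mF.
have cF := nondecreasing_cvg_mu mFn (bigcupT_measurable _ mFn) ndF.
rewrite -(cvg_lim _ (cF _ mu))//; apply: lime_le.
  by apply/cvg_ex; eexists; exact: cF.
apply: nearW => n /=.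
have : rearrangement mu f t < (a + n.+1%:R^-1)%:E.
  by apply: le_lt_trans fta _; rewrite lte_fin ltrDl.
move=> /ereal_inf_lt[_ [tau [tau0 ht] <-]] tn.
apply: le_trans ht; apply: le_measure; rewrite ?inE; [exact: mF|exact: mF|].
by move=> x; apply: le_lt_trans; exact: ltW.
Qed.

(** On []M j.+1, M j]], with [M j = m h^j] and [h = 2^{-s}], both factors of the Lorentz integrand
    are at least their values at [M j]. Since [h^{1/s} = 1/2], this interval contributes at least
    [(1 - h) m^{1/s} 2^{-j}] times the rearrangement at [M j]. *)
Lemma le_lorentz_norm (s m : R) (f : T -> \bar R) (n : nat) :
  (1 <= s)%R -> (0 < m)%R ->
  \sum_(j < n) ((2^-1 ^+ j)%:E * rearrangement mu f (m * (2 `^ (- s)) ^+ j)) <=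
    (s / ((1 - 2 `^ (- s)) * m `^ s^-1))%:E * lorentz_norm mu s f.
Proof.
move=> s1 m0; set h := (2 `^ (- s))%R.
have s0 : (0 < s)%R by exact: lt_le_trans s1.
have h0 : (0 < h)%R by rewrite powR_gt0.
have h1 : (h < 1)%R by exact: powR2N_lt1.
have hV : (h `^ s^-1 = 2^-1)%R.
  by rewrite /h -powRrM mulNr divff ?gt_eqF// powR_inv1.
pose M j := (m * h ^+ j)%R.
have M0 j : (0 < M j)%R by rewrite /M mulr_gt0// exprn_gt0.
have MS j : (M j.+1 < M j)%R.
  by rewrite /M exprS mulrCA gtr_pMl// M0.
set c := ((1 - h) * m `^ s^-1)%R.
have c0 : (0 < c)%R by rewrite mulr_gt0// ?subr_gt0// powR_gt0.
have cE j : (c * 2^-1 ^+ j = (M j) `^ (s^-1 - 1) * (M j - M j.+1))%R.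
  have -> : (M j - M j.+1 = M j * (1 - h))%R by rewrite /M exprS; ring.
  rewrite mulrA [(_ * M j)%R]mulrC mulr_powRB1 ?invr_gt0 ?ltW//.
  rewrite /M powRM ?ltW// ?exprn_gt0// (powR_exprAC _ _ (ltW h0)) hV.
  by rewrite /c; ring.
have -> : (s / c = c^-1 * s)%R by rewrite mulrC.
rewrite EFinM -muleA /lorentz_norm [(s%:E * _)%E]muleA -EFinM divff ?gt_eqF// mul1e.
rewrite lee_pdivlMl//.
set I := integral _ _ _.
rewrite ge0_sume_distrr; last first.
  move=> j _; apply: mule_ge0; last exact: rearrangement_ge0.
  by rewrite lee_fin exprn_ge0.
pose W (j : nat) t := rearrangement mu f (M j) *
   ((M j) `^ (s^-1 - 1) * \1_(`]M j.+1, M j]%classic : set R) t)%:E.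
have W0 j t : 0 <= W j t.
  by apply: mule_ge0; [exact: rearrangement_ge0|rewrite lee_fin mulr_ge0// powR_ge0].
have mW j (D : set R) : measurable_fun D (W j).
  apply: measurable_funeM; apply/measurable_EFinP; apply: measurable_funM => //.
have -> : \sum_(j < n) (c%:E * ((2^-1 ^+ j)%:E * rearrangement mu f (m * h ^+ j)))
    = \int[lebesgue_measure]_(t in `]0%R, +oo[) (\sum_(j < n) W j t).
  transitivity (\sum_(j < n) \int[lebesgue_measure]_(t in `]0%R, +oo[) W j t); last first.
    apply/esym; apply: (@ge0_integral_sum _ _ _ lebesgue_measure
      `]0%R, +oo[%classic _ _ (fun j : 'I_n => W j)).
    - exact: measurable_itv.
    - by move=> j; exact: mW.
    - by move=> j t _; exact: W0.
  apply: eq_bigr => j _.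
  rewrite ge0_integralZl//; first last.
  - exact: rearrangement_ge0.
  - by move=> t _; rewrite lee_fin mulr_ge0// powR_ge0.
  - by apply/measurable_EFinP; exact: measurable_funM.
  under eq_integral do rewrite EFinM.
  rewrite ge0_integralZl_EFin ?powR_ge0//; last exact/measurable_EFinP.
  rewrite integral_indic//= setIidl.
    rewrite lebesgue_measure_itv/= lte_fin MS -EFinD muleA -EFinM cE -EFinM.
    by rewrite muleC.
  by move=> t /=; rewrite !in_itv/= andbT => /andP[+ _]; exact: lt_trans.
apply: le_nonneg_integral => t /=; rewrite in_itv/= andbT => t0.
  by apply: sume_ge0.
have F0 : 0 <= rearrangement mu f t * (t `^ (s^-1 - 1))%:E.
  by rewrite mule_ge0 ?rearrangement_ge0// lee_fin powR_ge0.
(* The first [k] intervals are disjoint and make up []M k, M 0]]: the sum vanishes for [t <= M k],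
   and otherwise has at most one nonzero term. *)
suff H k : \sum_(j < k) W j t <=
    (if (M k < t)%R then rearrangement mu f t * (t `^ (s^-1 - 1))%:E else 0).
  by apply: le_trans (H n) _; case: ifP.
elim: k => [|k IH]; first by rewrite big_ord0; case: ifP.
rewrite big_ord_recr/= /W indicE mem_setE in_itv/=.
case: ltP IH => [Mkt|tMk] IH.
  rewrite andbF mulr0 mule0 adde0.
  by rewrite (lt_trans (MS k) Mkt).
rewrite andbT; apply: (@le_trans _ _ (0 + rearrangement mu f (M k) *
  (M k `^ (s^-1 - 1) * (M k.+1 < t)%R%:R)%:E)); first exact: leeD.
rewrite add0e; case: ifPn => _; last by rewrite mulr0 mule0.
rewrite mulr1; apply: lee_pmul; rewrite ?rearrangement_ge0 ?lee_fin ?powR_ge0//.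
  exact: le_rearrangement.
have -> : (s^-1 - 1 = - (1 - s^-1))%R by ring.
rewrite !powRN lef_pV2 ?posrE ?powR_gt0//.
have e0 : (0 <= 1 - s^-1)%R by rewrite subr_ge0 invf_le1.
by apply: (ge0_ler_powR e0) => //; rewrite nnegrE; exact: ltW.
Qed.

End rearrangement.

(** * Inequalities for sums of non-negative sequences *)

Lemma sum_powR_le (R : realType) (p S : R) (a : nat -> R) (n : nat) :
  1 <= p -> (forall k, 0 <= a k) -> \sum_(k < n) a k <= S ->
  \sum_(k < n) a k `^ p <= S `^ p.
Proof.
move=> p1 a0 aS; have p0 : 0 < p by exact: lt_le_trans p1.
have S0 : 0 <= S by apply: le_trans aS; exact: sumr_ge0.
(* Each [a k] is a term of the sum, hence at most [S]. *)
apply: (@le_trans _ _ (\sum_(k < n) a k * S `^ (p - 1))).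
  apply: ler_sum => k _; rewrite -[leLHS]mulr_powRB1// ler_wpM2l//.
  apply: ge0_ler_powR; rewrite ?nnegrE ?subr_ge0//.
  apply: le_trans aS; rewrite (bigD1 k)//= lerDl; exact: sumr_ge0.
by rewrite -mulr_suml -(mulr_powRB1 S0 p0) ler_wpM2r// powR_ge0.
Qed.

Lemma geometric_sum_le (R : realType) (q : R) (n : nat) : 0 <= q -> q < 1 ->
  \sum_(k < n) q ^+ k <= (1 - q)^-1.
Proof.
move=> q0 q1; rewrite -[leRHS]mul1r ler_pdivlMr ?subr_gt0//.
have -> : (\sum_(k < n) q ^+ k) * (1 - q) = 1 - q ^+ n.
  by apply: oppr_inj; rewrite -mulrN !opprB subrX1 mulrC.
by rewrite lerBlDr lerDl exprn_ge0.
Qed.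

(* Discrete Hardy inequality: [A i] is [b i] plus a geometric average of the
   later terms, so that it is summable when [b] is. *)
Lemma discrete_hardy (R : realType) (b : nat -> R) (q L : R) :
  (forall k, 0 <= b k) -> 0 <= q -> q < 1 ->
  (forall n, \sum_(k < n) b k <= L) ->
  exists A : nat -> R,
    (forall i n, b i + 2 * \sum_(k < n) b (i + k).+1 * q ^+ k <= A i) /\
    (forall n, \sum_(i < n) A i <= (1 + 2 / (1 - q)) * L).
Proof.
move=> b0 q0 q1 bL.
have L0 : 0 <= L by have := bL 0%N; rewrite big_ord0.
pose F i n := b i + 2 * \sum_(k < n) b (i + k).+1 * q ^+ k.
have F0 i n : 0 <= F i n.
  by rewrite addr_ge0// mulr_ge0// sumr_ge0// => k _; rewrite mulr_ge0// exprn_ge0.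
have bS N k : \sum_(i < N) b (i + k).+1 <= L.
  apply: le_trans (bL (k.+1 + N)%N); rewrite big_split_ord/=.
  rewrite -[leLHS]add0r lerD ?sumr_ge0//.
  by apply: ler_sum => i _; rewrite addnC addSn.
have FL N n : \sum_(i < N) F i n <= (1 + 2 / (1 - q)) * L.
  rewrite /F big_split/= mulrDl mul1r; apply: lerD; first exact: bL.
  rewrite -mulr_sumr -mulrA ler_wpM2l//.
  (* For fixed [k] the sum over [i] runs through a shifted segment of [b], which [bS] bounds by [L];
     a geometric series in [k] remains. *)
  rewrite exchange_big/=.
  apply: (@le_trans _ _ (\sum_(k < n) L * q ^+ k)).
    apply: ler_sum => k _; rewrite -mulr_suml.
    by apply: ler_wpM2r; [exact: exprn_ge0|exact: bS].
  by rewrite -big_distrr/= mulrC ler_wpM2r// geometric_sum_le.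
have ndF i : nondecreasing_seq (F i).
  apply/nondecreasing_seqP => n.
  by rewrite /F lerD2l ler_wpM2l// big_ord_recr/= lerDl mulr_ge0// exprn_ge0.
have cF i : cvgn (F i).
  apply: nondecreasing_is_cvgn => //; exists ((1 + 2 / (1 - q)) * L) => _ [n _ <-].
  by apply: le_trans (FL i.+1 n); rewrite big_ord_recr/= lerDr sumr_ge0.
(* [A i] is the series with partial sums [F i n]. A finite sum over [i] commutes with the limit, so
   the uniform bound [FL] passes to [A]. *)
exists (fun i => limn (F i)); split; first by move=> i n; exact: nondecreasing_cvgn_le.
move=> N; have cS : \sum_(i < N) F i n @[n --> \oo] --> \sum_(i < N) limn (F i).
  elim: N => [|N IH].
    rewrite big_ord0; under eq_fun do rewrite big_ord0; exact: cvg_cst.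
  rewrite big_ord_recr; under eq_fun do rewrite big_ord_recr.
  by apply: cvgD => //; exact: cF.
rewrite -(cvg_lim _ cS)//; apply: limr_le; first by apply/cvg_ex; eexists; exact: cS.
by apply: nearW => n; exact: FL.
Qed.

(** * Averages of powers, controlled by the rearrangement *)

Lemma integral_poweR_levels d (T : measurableType d) (R : realType)
    (mu : {measure set T -> \bar R}) (f : T -> \bar R) (p h m S : R)
    (g : nat -> R) (D : set T) :
  measurable_fun setT f -> (forall x, 0 <= f x)%E -> 1 <= p -> 0 < h -> h < 1 ->
  (forall k, 0 <= g k) ->
  (forall k, mu [set x | (g k)%:E < f x] <= (m * h ^+ k)%:E)%E ->
  measurable D -> 0 <= m -> (m%:E <= mu D)%E ->
  (forall n, g 0%N + \sum_(k < n) g k.+1 * (h `^ p^-1) ^+ k <= S) ->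
  (\int[mu]_(x in D) poweR (f x) p <= (S `^ p)%:E * mu D)%E.
Proof.
move=> mf f0 p1 h0 h1 g0 gm mD m0 mleD gS.
have p0 : 0 < p by exact: lt_le_trans p1.
(* [f] exceeds every level [g k] only on a null set, since [m h^k] tends to 0. *)
pose N := \bigcap_k [set x | ((g k)%:E < f x)%E].
have mE k : measurable [set x | ((g k)%:E < f x)%E] by exact: measurable_superlevel.
have mN : measurable N by exact: bigcapT_measurable.
have N0 : mu N = 0%E.
  have cm : (m * h ^+ k)%:E @[k --> \oo] --> 0%E.
    apply: cvg_EFin; first exact: nearW.
    rewrite -[X in _ --> X](mulr0 m); apply: cvgMr; apply: cvg_expr.
    by rewrite ger0_norm// ltW.
  apply/eqP; rewrite eq_le measure_ge0 andbT -(cvg_lim _ cm)//.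
  apply: lime_ge; first by apply/cvg_ex; eexists; exact: cm.
  apply: nearW => k; apply: le_trans (gm k).
  by apply: le_measure; rewrite ?inE// => x; apply.
(* The index is shifted by one: the value [g k] is used where [f] exceeds the previous level, a set
   of measure at most [m h^(k-1)], and [g 0] is used everywhere. *)
pose E k := if k is k'.+1 then [set x | ((g k')%:E < f x)%E] else setT.
have mEk k : measurable (E k) by case: k => [|k]; [exact: measurableT|exact: mE].
pose W k x : \bar R := ((g k `^ p)%:E * (\1_(E k) x)%:E)%E.
have W0 k x : (0 <= W k x)%E by rewrite mule_ge0// lee_fin powR_ge0.
have mI k (A : set T) : measurable_fun A (fun x => (\1_(E k) x : R)%:E).
  by apply/measurable_EFinP; apply: measurable_indic; exact: mEk.
have mW k (A : set T) : measurable_fun A (W k) by exact: measurable_funeM.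
have fW x : ~ N x -> (poweR (f x) p <= \sum_(0 <= k <oo) W k x)%E.
  move=> Nx; have exk : exists k, (f x <= (g k)%:E)%E.
    apply: contrapT => nk; apply: Nx => k _ /=; rewrite ltNge; apply/negP => fk.
    by apply: nk; exists k.
  (* At the first [k] with [f x <= g k], the point lies in [E k], so the single term [W k x] already
     dominates. *)
  case: (ex_minnP exk) => k fk kmin.
  have Ek : E k x.
    case: k fk kmin => [//|k] _ kmin /=.
    by rewrite ltNge; apply/negP => /kmin; rewrite ltnn.
  apply: le_trans (nneseries_lim_ge k.+1 _); last by move=> *; exact: W0.
  rewrite big_nat_recr//=; apply: (@le_trans _ _ (0 + W k x)%E); last first.
    by apply: leeD => //; exact: sume_ge0.
  rewrite add0e /W indicE mem_set// mule1.
  rewrite -poweR_EFin; apply: gt0_ler_poweR => //; rewrite ?ltW//.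
    by rewrite in_itv/= leey f0.
  by rewrite in_itv/= leey lee_fin g0.
have mp : measurable_fun D (fun x => poweR (f x) p).
  apply: measurable_funTS.
  by apply: (measurableT_comp (measurable_poweR p)).
apply: (@le_trans _ _ (\int[mu]_(x in D) (\sum_(0 <= k <oo) W k x)%E)%E).
  apply: ae_ge0_le_integral => //.
  - by move=> x _; exact: poweR_ge0.
  - by move=> x _; exact: nneseries_ge0.
  - by apply: ge0_emeasurable_sum => k; [move=> x _ _; exact: W0|move=> _; exact: mW].
  - exists N; split => // x /= Hx; apply: contrapT => /fW Nx; exact: Hx.
rewrite integral_nneseries//.
pose a k := if k is k'.+1 then g k'.+1 * (h `^ p^-1) ^+ k' else g 0%N.
have a0 k : 0 <= a k by case: k => //= k; rewrite mulr_ge0// exprn_ge0// powR_ge0.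
have aS n : \sum_(k < n) a k <= S.
  apply: le_trans (gS n); have -> : g 0%N + \sum_(k < n) g k.+1 * h `^ p^-1 ^+ k =
      \sum_(k < n.+1) a k by rewrite big_ord_recl.
  by rewrite big_ord_recr/= lerDl.
have WE k : (\int[mu]_(x in D) W k x <= (a k `^ p)%:E * mu D)%E.
  rewrite ge0_integralZl_EFin ?powR_ge0// integral_indic//.
  case: k => [|k]; first by rewrite setTI.
  rewrite /a powRM ?exprn_ge0 ?powR_ge0//.
  have -> : ((h `^ p^-1 ^+ k) `^ p = h ^+ k)%R.
    by rewrite powR_exprAC ?powR_ge0// -powRrM mulVf ?gt_eqF// powRr1// ltW.
  rewrite EFinM -muleA lee_wpmul2l// ?lee_fin ?powR_ge0//.
  apply: (@le_trans _ _ (m * h ^+ k)%:E).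
    apply: le_trans (gm k); apply: le_measure; rewrite ?inE//; exact: measurableI.
  by rewrite mulrC EFinM lee_wpmul2l// lee_fin exprn_ge0// ltW.
apply: lime_le; first by apply: is_cvg_nneseries => k _ _; exact: integral_ge0.
apply: nearW => n.
apply: (@le_trans _ _ (\sum_(0 <= k < n) (a k `^ p)%:E * mu D)%E).
  by apply: lee_sum => k _; exact: WE.
rewrite -ge0_sume_distrl; last by move=> k _; rewrite lee_fin powR_ge0.
rewrite lee_wpmul2r// sumEFin lee_fin big_mkord.
exact: sum_powR_le.
Qed.

Lemma lorentz_norm_ge0 (R : realType) (d : measure_display)
    (T : metricMeasurableType R d) (mu : {measure set T -> \bar R}) (q : R)
    (f : T -> \bar R) : 0 <= q -> (0 <= lorentz_norm mu q f)%E.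
Proof.
move=> q0; apply: mule_ge0; first by rewrite lee_fin invr_ge0.
by apply: integral_ge0 => t _; rewrite mule_ge0 ?rearrangement_ge0// lee_fin powR_ge0.
Qed.

(** Let [g j] be the rearrangement at [m h^j], [b j = 2^{-j} g j] and [q = 2 h^{1/p}]. The level-set
    estimate bounds the L^p average over a set of measure at least [m h^i] by [2^i] times the sum of
    [b i] and of all [2 b (i + k + 1) q^k]. The discrete Hardy inequality makes these bounds
    summable, the sum of the [b j] being controlled by the Lorentz norm. *)
Lemma lorentz_averages (R : realType) (p s : R) : 1 <= p -> p < s ->
  exists2 C : R, 0 < C & forall (d : measure_display)
    (T : metricMeasurableType R d) (mu : {measure set T -> \bar R})
    (f : T -> \bar R) (m : R),
    measurable_fun setT f -> (forall x, 0 <= f x)%E -> 0 < m ->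
    (lorentz_norm mu s f < +oo)%E ->
    exists A : nat -> R, [/\ (forall i, 0 <= A i),
      (forall n, (\sum_(i < n) A i)%:E <= (C / m `^ s^-1)%:E * lorentz_norm mu s f)%E
    & (forall i D, measurable D -> ((m * (2 `^ (- s)) ^+ i)%:E <= mu D < +oo)%E ->
        poweR (average mu D (fun x => poweR (f x) p)) p^-1 <= (2 ^+ i * A i)%:E)%E].
Proof.
move=> p1 ps; have p0 : 0 < p by exact: lt_le_trans p1.
have s0 : 0 < s by exact: lt_trans ps.
have s1 : 1 <= s by apply: le_trans p1 (ltW ps).
set h := 2 `^ (- s).
have h0 : 0 < h by rewrite powR_gt0.
have h1 : h < 1 by exact: powR2N_lt1.
pose th := h `^ p^-1; pose q := 2 * th.
have th0 : 0 < th by rewrite powR_gt0.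
have q0 : 0 < q by rewrite mulr_gt0.
(* [q = 2^{1 - s/p}], so this is the condition [p < s]. *)
have q1 : q < 1.
  rewrite /q /th /h -powRrM -[X in X * _](powRr1 (ler0n R 2)) -powRD; last by apply/implyP.
  have -> : 1 + - s * p^-1 = - (s / p - 1) by ring.
  by rewrite powR2N_lt1// subr_gt0 ltr_pdivlMr// mul1r.
pose K := 1 + 2 / (1 - q).
have K0 : 0 < K by rewrite addr_gt0// divr_gt0// subr_gt0.
exists (K * (s / (1 - h))); first by rewrite mulr_gt0// divr_gt0// subr_gt0.
move=> d T mu f m mf f0 m0 Lfin.
have ms0 : 0 < m `^ s^-1 by rewrite powR_gt0.
have L0 : (0 <= lorentz_norm mu s f)%E by rewrite lorentz_norm_ge0// ltW.
pose l := fine (lorentz_norm mu s f).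
have lE : lorentz_norm mu s f = l%:E by rewrite fineK// ge0_fin_numE.
pose c := s / ((1 - h) * m `^ s^-1).
have c0 : 0 < c by rewrite divr_gt0// mulr_gt0// subr_gt0.
have Lor n := le_lorentz_norm mu f n s1 m0.
pose g j := fine (rearrangement mu f (m * h ^+ j)).
have gE j : rearrangement mu f (m * h ^+ j) = (g j)%:E.
  rewrite fineK// ge0_fin_numE ?rearrangement_ge0//.
  have : ((2^-1 ^+ j)%:E * rearrangement mu f (m * h ^+ j) < +oo)%E.
    apply: (@le_lt_trans _ _ (c%:E * lorentz_norm mu s f)%E).
      apply: le_trans (Lor j.+1); rewrite big_ord_recr/= leeDr// sume_ge0// => i _.
      by rewrite mule_ge0 ?rearrangement_ge0// lee_fin exprn_ge0.
    by rewrite lE -EFinM ltry.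
  case: (rearrangement _ _ _) => [r| |]//; rewrite ?ltry//.
  by rewrite gt0_muley// lte_fin exprn_gt0.
have g0 j : 0 <= g j by rewrite fine_ge0// rearrangement_ge0.
pose b j := 2^-1 ^+ j * g j.
have b0 j : 0 <= b j by rewrite mulr_ge0// exprn_ge0.
have bL n : \sum_(k < n) b k <= c * l.
  rewrite -lee_fin EFinM -lE -sumEFin; apply: le_trans (Lor n).
  by apply: lee_sum => k _; rewrite gE.
have [A [bA AL]] := discrete_hardy b0 (ltW q0) q1 bL.
exists A; split => [i|n|i D mD /andP[mleD Dfin]].
- by apply: le_trans (bA i 0%N); rewrite big_ord0 mulr0 addr0.
- rewrite lE -EFinM lee_fin; apply: le_trans (AL n) _.
  rewrite le_eqVlt; apply/orP; left; apply/eqP; rewrite /c /K.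
  by field; rewrite !gt_eqF ?subr_gt0.
have mi0 : 0 < m * h ^+ i by rewrite mulr_gt0// exprn_gt0.
have D0 : (0 < mu D)%E by apply: lt_le_trans mleD; rewrite lte_fin.
have H : (\int[mu]_(x in D) poweR (f x) p <= ((2 ^+ i * A i) `^ p)%:E * mu D)%E.
  apply: (@integral_poweR_levels _ _ _ _ _ _ h (m * h ^+ i) _ (fun k => g (i + k)%N)) => //.
  - move=> k; rewrite -mulrA -exprD.
    have := @rearrangement_superlevel _ _ _ mu f (m * h ^+ (i + k)) (g (i + k)%N) mf.
    rewrite gE lexx => /(_ isT); under eq_set do rewrite gee0_abs//.
    by [].
  - by rewrite ltW.
  - move=> n; apply: le_trans (ler_wpM2l (exprn_ge0 i (ler0n R 2)) (bA i n)).
    rewrite /b mulrDr mulrA -exprMn divff// expr1n mul1r addn0 lerD2l.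
    rewrite !mulr_sumr; apply: ler_sum => k _; rewrite addnS /q.
    rewrite le_eqVlt; apply/orP; left; apply/eqP.
    rewrite exprMn -addnS exprD exprS !exprVn; field.
    by rewrite !expf_neq0.
have mDE : mu D = (fine (mu D))%:E by rewrite fineK// ge0_fin_numE.
have fD0 : 0 < fine (mu D) by rewrite fine_gt0// D0.
have S0 : 0 <= 2 ^+ i * A i.
  rewrite mulr_ge0 ?exprn_ge0//; apply: le_trans (bA i 0%N).
  by rewrite big_ord0 mulr0 addr0.
have -> : (2 ^+ i * A i)%:E = poweR ((2 ^+ i * A i) `^ p)%:E p^-1.
  by rewrite poweR_EFin -powRrM divff ?gt_eqF// powRr1.
have avle : (average mu D (fun x => poweR (f x) p) <= ((2 ^+ i * A i) `^ p)%:E)%E.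
  rewrite /average mDE inver gt_eqF// lee_pdivrMl//.
  by rewrite muleC -mDE.
apply: gt0_ler_poweR => //; rewrite ?invr_ge0 ?ltW// in_itv/= leey andbT.
  rewrite /average mule_ge0 ?inve_ge0 ?measure_ge0//.
  by apply: integral_ge0 => x _; exact: poweR_ge0.
by rewrite lee_fin powR_ge0.
Qed.

(** * Balls, nets and averages *)

Section metric_measure.
Context {R : realType} {d : measure_display} {T : metricMeasurableType R d}.
Variable mu : {measure set T -> \bar R}.
Hypothesis hmu : borel_regular_measure mu.
Local Open Scope ereal_scope.

Lemma open_metric_ball (x : T) (r : R) : open (ball x r).
Proof.
rewrite openE => y; rewrite ballEmdist /= => xy.
have e0 : (0 < r - mdist x y)%R by rewrite subr_gt0.
apply/nbhs_ballP; exists (r - mdist x y)%R => // z; rewrite ballEmdist /= => yz.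
by apply: le_lt_trans (metric_triangle x y z) _; rewrite -ltrBrDl.
Qed.

Lemma measurable_metric_ball (x : T) (r : R) : measurable (ball x r).
Proof.
by have [_ + _ _] := hmu; apply; apply: sub_sigma_algebra; exact: open_metric_ball.
Qed.
Local Hint Resolve measurable_metric_ball : core.

Lemma measure_ball_gt0 (x : T) (r : R) : (0 < r)%R -> 0 < mu (ball x r).
Proof. by have [_ _ _ h] := hmu; move=> /(h x r)/andP[]. Qed.

Lemma measure_ball_lty (x : T) (r : R) : (0 < r)%R -> mu (ball x r) < +oo.
Proof. by have [_ _ _ h] := hmu; move=> /(h x r)/andP[]. Qed.

Lemma measure_ball_fine (x : T) (r : R) : (0 < r)%R ->
  mu (ball x r) = (fine (mu (ball x r)))%:E.
Proof. by move=> r0; rewrite fineK// ge0_fin_numE ?measure_ball_lty. Qed.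

Lemma fine_measure_ball_gt0 (x : T) (r : R) : (0 < r)%R ->
  (0 < fine (mu (ball x r)))%R.
Proof. by move=> r0; rewrite fine_gt0// measure_ball_gt0// measure_ball_lty. Qed.

Lemma sub_ball (x y : T) (r r' : R) : (mdist x y + r <= r')%R ->
  ball y r `<=` ball x r'.
Proof.
move=> h z; rewrite !ballEmdist /= => yz.
by apply: le_lt_trans (metric_triangle x y z) _; apply: lt_le_trans h; rewrite ltrD2l.
Qed.

Lemma dimension_ball (s c : R) (x y : T) (r rho : R) :
  (forall (x y : T) (r rho : R), (0 < r)%R -> (r <= rho)%R -> ball x rho y ->
      (c * (r / rho) `^ s)%:E <= mu (ball y r) / mu (ball x rho)) ->
  (0 < r)%R -> (r <= rho)%R -> ball x rho y ->
  (c * (r / rho) `^ s * fine (mu (ball x rho)))%:E <= mu (ball y r).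
Proof.
move=> hs r0 rrho xy; have rho0 : (0 < rho)%R by exact: lt_le_trans rrho.
have := hs _ _ _ _ r0 rrho xy.
rewrite (measure_ball_fine x rho0) inver gt_eqF ?fine_measure_ball_gt0//.
by rewrite lee_pdivlMr ?fine_measure_ball_gt0.
Qed.

Lemma separated_balls (s : seq T) (rho : R) :
  pairwise (fun y z : T => (2 * rho <= mdist y z)%R) s ->
  mu (\big[setU/set0]_(y <- s) ball y rho) = \sum_(y <- s) mu (ball y rho).
Proof.
elim: s => [|y s IH]; first by rewrite !big_nil measure0.
rewrite pairwise_cons => /andP[/allP ys ss].
have mU : measurable (\big[setU/set0]_(z <- s) ball z rho) by exact: bigsetU_measurable.
rewrite !big_cons measureU//; first by congr (_ + _); exact: IH.
apply/seteqP; split => // z [yz]; rewrite -bigcup_seq => -[t /= /ys yt tz].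
have := metric_triangle y z t.
move: yz tz; rewrite !ballEmdist /= [mdist t z]metric_sym => yz tz.
lra.
Qed.

(** The net is a maximal [rho]-separated subset of the ball. The balls of radius [rho / 2] about its
    points are disjoint, lie in the doubled ball and have measure bounded below by the dimension
    condition, which bounds the cardinality; doubling then returns to radius [rho]. *)
Lemma finite_net (k s c : R) (x : T) (r rho : R) :
  (forall (x : T) (r : R), (0 < r)%R -> mu (ball x (2 * r)) <= k%:E * mu (ball x r)) ->
  (0 < c)%R ->
  (forall (x y : T) (r rho : R), (0 < r)%R -> (r <= rho)%R -> ball x rho y ->
      (c * (r / rho) `^ s)%:E <= mu (ball y r) / mu (ball x rho)) ->
  (0 < rho)%R -> (rho <= r)%R ->
  exists t : seq T, [/\ (forall y, y \in t -> ball x r y),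
    ball x r `<=` \big[setU/set0]_(y <- t) ball y rho
    & \sum_(y <- t) mu (ball y rho) <= k%:E * mu (ball x (2 * r))].
Proof.
move=> hk c0 hs rho0 rhor; have r0 : (0 < r)%R by exact: lt_le_trans rhor.
pose hrho := (rho / 2)%R; have hrho0 : (0 < hrho)%R by rewrite divr_gt0.
have rhoE : (2 * hrho = rho)%R by rewrite /hrho mulrC divfK.
pose sep (t : seq T) := (forall y, y \in t -> ball x r y) /\
  pairwise (fun y z : T => (2 * hrho <= mdist y z)%R) t.
have sepV t : sep t -> \sum_(y <- t) mu (ball y hrho) <= mu (ball x (2 * r)).
  move=> [tx ts]; rewrite -separated_balls//.
  apply: le_measure; rewrite ?inE//; first exact: bigsetU_measurable.
  move=> z; rewrite -bigcup_seq => -[y /= yt]; apply: sub_ball.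
  by move: (tx _ yt); rewrite ballEmdist /= /hrho; lra.
pose del := (c * (hrho / r) `^ s * fine (mu (ball x r)))%R.
have del0 : (0 < del)%R.
  by rewrite !mulr_gt0 ?powR_gt0 ?divr_gt0 ?fine_measure_ball_gt0.
have sepn t : sep t -> ((size t)%:R * del <= fine (mu (ball x (2 * r))))%R.
  move=> st; rewrite -lee_fin -measure_ball_fine ?mulr_gt0//.
  apply: le_trans (sepV t st).
  apply: (@le_trans _ _ (\sum_(y <- t) del%:E)).
    by rewrite sumEFin lee_fin big_const_seq count_predT iter_addr_0 mulr_natl.
  rewrite big_seq [leRHS]big_seq; apply: lee_sum => y yt.
  apply: dimension_ball => //; last by case: st => /(_ _ yt).
  by rewrite /hrho; lra.
pose P n := `[< exists t, sep t /\ size t = n >].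
have exP : exists n, P n by exists 0%N; apply/asboolP; exists [::]; split.
pose N := Num.trunc (fine (mu (ball x (2 * r))) / del)%R.
have PN n : P n -> (n <= N)%N.
  move=> /asboolP[t [st <-]].
  have := sepn t st; rewrite -ler_pdivlMr// => h.
  rewrite -ltnS -(ltr_nat R); apply: le_lt_trans h _.
  exact: truncnS_gt.
case: (ex_maxnP exP PN) => n /asboolP[t [st tn]] nmax.
exists t; split; first by case: st.
  move=> z xz; rewrite -bigcup_seq; apply: contrapT => nz.
  suff : P n.+1 by move=> /nmax; rewrite ltnn.
  apply/asboolP; exists (z :: t); split; last by rewrite /= tn.
  case: st => tx ts; split.
    by move=> y; rewrite inE => /orP[/eqP->//|/tx].
  rewrite pairwise_cons ts andbT; apply/allP => y yt.
  rewrite leNgt; apply/negP => yz; apply: nz; exists y => //=.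
  by rewrite ballEmdist /= metric_sym -rhoE.
apply: (@le_trans _ _ (\sum_(y <- t) k%:E * mu (ball y hrho))).
  by apply: lee_sum => y _; rewrite -rhoE; exact: hk.
rewrite -ge0_sume_distrr//.
have k0 : (0 <= k)%R.
  rewrite -lee_fin -(@pmule_lge0 _ (mu (ball x r))) ?measure_ball_gt0//.
  by apply: le_trans (hk x r r0).
by rewrite lee_wpmul2l ?lee_fin// sepV.
Qed.

(** Shrinking the domain multiplies the mean of [|u - a|] by at most [mu D' / mu D <= k]. With [a]
    the average over [D'], this compares the averages over two nested sets. *)
Lemma average_sub_le (D D' : set T) (u : T -> \bar R) (a k o : R) :
  measurable D -> measurable D' -> D `<=` D' -> 0 < mu D -> mu D' < +oo ->
  (0 <= k)%R -> mu.-integrable D' u -> mu D' <= k%:E * mu D ->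
  average mu D' (fun y => `|u y - a%:E|) <= o%:E ->
  `|average mu D u - a%:E| <= (k * o)%:E.
Proof.
move=> mD mD' DD' D0 D'y k0 iu kD avo.
have Dy : mu D < +oo by apply: le_lt_trans D'y; apply: le_measure; rewrite ?inE.
have DE : mu D = (fine (mu D))%:E by rewrite fineK// ge0_fin_numE.
have fD0 : (0 < fine (mu D))%R by rewrite fine_gt0// D0.
have D'0 : 0 < mu D' by apply: lt_le_trans D0 _; apply: le_measure; rewrite ?inE.
have D'E : mu D' = (fine (mu D'))%:E by rewrite fineK// ge0_fin_numE.
have fD'0 : (0 < fine (mu D'))%R by rewrite fine_gt0// D'0.
have iD : mu.-integrable D u by exact: integrableS iu.
have ica : mu.-integrable D (cst a%:E).
  apply/integrableP; split; first exact: measurable_cst.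
  by rewrite integral_cst// DE -EFinM ltry.
have ica' : mu.-integrable D' (cst a%:E).
  apply/integrableP; split; first exact: measurable_cst.
  by rewrite integral_cst// D'E -EFinM ltry.
have mua : measurable_fun D' (fun y => u y - a%:E).
  by case/integrableP: (integrableB mD' iu ica').
have -> : average mu D u - a%:E = (mu D)^-1 * \int[mu]_(y in D) (u y - a%:E).
  rewrite /average (integralB mD iD ica) integral_cst//.
  rewrite -(fineK (integrable_fin_num mD iD)) DE inver gt_eqF// -!EFinM -EFinB.
  by congr _%:E; field; rewrite gt_eqF.
rewrite DE inver gt_eqF// abseM gee0_abs ?lee_fin ?invr_ge0 ?(ltW fD0)//.
rewrite lee_pdivrMl//.
apply: le_trans (le_abse_integral _ _ _) _ => //; first exact: measurable_funS mua.
apply: (@le_trans _ _ (\int[mu]_(y in D') `|u y - a%:E|)).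
  by apply: ge0_subset_integral => //; exact: measurableT_comp.
have o0 : (0 <= o)%R.
  rewrite -lee_fin; apply: le_trans avo.
  by rewrite /average mule_ge0 ?inve_ge0 ?measure_ge0// integral_ge0.
move: avo; rewrite /average D'E inver gt_eqF// lee_pdivrMl// => avo.
apply: le_trans avo _.
move: kD; rewrite D'E DE -!EFinM !lee_fin => kD.
by rewrite mulrA [(_ * k)%R]mulrC ler_wpM2r.
Qed.

End metric_measure.

(** * The oscillation bound almost everywhere *)

(** Otherwise the partial sums would grow linearly. This yields a scale of small mean oscillation;
    the index starts at 1 because the radii used below are at most [r] from there on. *)
Lemma bounded_sums_small (R : realType) (A : nat -> R) (L e : R) :
  (forall i, 0 <= A i) -> (forall n, \sum_(i < n) A i <= L) -> 0 < e ->
  exists n, A n.+1 < e.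
Proof.
move=> A0 AL e0; apply: contrapT => nA.
have eA n : e <= A n.+1 by rewrite leNgt; apply/negP => h; apply: nA; exists n.
pose N := (Num.trunc (L / e)).+1.
have : e * N%:R <= L.
  apply: le_trans (AL N.+1); rewrite big_ord_recl/=.
  have -> : e * N%:R = \sum_(i < N) e by rewrite sumr_const card_ord mulr_natr.
  by rewrite -[leLHS]add0r lerD//; apply: ler_sum => i _; exact: eA.
rewrite mulrC -ler_pdivlMr// leNgt.
by rewrite truncnS_gt.
Qed.

Lemma measure_bigsetU_le d (T : measurableType d) (R : realType)
    (mu : {measure set T -> \bar R}) (I : Type) (F : I -> set T) (s : seq I) :
  (forall i, measurable (F i)) ->
  (mu (\big[setU/set0]_(i <- s) F i) <= \sum_(i <- s) mu (F i))%E.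
Proof.
move=> mF; elim: s => [|i s IH]; first by rewrite !big_nil measure0.
rewrite !big_cons; apply: le_trans (measureU2 _ _ _) _ => //.
  exact: bigsetU_measurable.
exact: leeD.
Qed.

Section ae_oscillation.
Context {R : realType} {d : measure_display} {T : metricMeasurableType R d}.
Variable mu : {measure set T -> \bar R}.
Hypothesis hmu : borel_regular_measure mu.
Local Open Scope ereal_scope.
Local Notation mB := (measurable_metric_ball hmu).
Local Notation vol x r := (fine (mu (ball x r))).

Lemma borel_fun_measurable (g : T -> \bar R) : borel_fun g -> measurable_fun setT g.
Proof.
move=> mg _ Y mY; have [_ + _ _] := hmu; apply.
exact: (mg measurableT Y mY).
Qed.

Lemma average_fin_num (D : set T) (u : T -> \bar R) : measurable D ->
  0 < mu D -> mu.-integrable D u -> average mu D u \is a fin_num.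
Proof.
move=> mD D0 iu; rewrite /average fin_numM ?integrable_fin_num//.
by rewrite fin_numV ?gt_eqF ?gt_eqF// (lt_trans _ D0).
Qed.

Lemma diam_ball (x : T) (r : R) : diam (ball x r) <= (2 * r)%:E.
Proof.
apply: ge_ereal_sup => _ [[y z] [/= xy xz] <-]; rewrite lee_fin.
apply: le_trans (metric_triangle y x z) _; move: xy xz; rewrite !ballEmdist /=.
rewrite [mdist y x]metric_sym; lra.
Qed.

(** The averages over [ball y (rad i)] are compared scale by scale with the average over [ball x r],
    by way of [ball x (2 * r)]. The differences add up to at most [K], so a point where [|u - u_B|]
    exceeds [K] by a margin is one where [u] stays away from the average over the small balls. *)
Lemma ae_oscillation_bound (p s lam : R) :
  doubling mu -> dimension_condition mu s -> poincare mu p lam ->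
  (1 <= p)%R -> (p < s)%R -> (1 <= lam)%R ->
  exists2 C : R, (0 < C)%R & forall (x : T) (r : R) (u G : T -> \bar R) (K : R),
    (0 < r)%R -> L1loc mu u -> upper_gradient u G ->
    lorentz_norm mu s (G \_ (ball x (2 * lam * r))) < +oo ->
    (C * r / (vol x (2 * lam * r)) `^ s^-1)%:E *
      lorentz_norm mu s (G \_ (ball x (2 * lam * r))) <= K%:E ->
    mu (ball x r `&` [set y | K%:E < `|u y - average mu (ball x r) u|]) = 0.
Proof.
move=> [k k1 hk] [c c0 hs] [cP cP0 hP] p1 ps lam1.
have [CA CA0 hA] := lorentz_averages p1 ps.
have s0 : (0 < s)%R by rewrite (lt_trans _ ps)// (lt_le_trans _ p1).
have lam0 : (0 < lam)%R by exact: lt_le_trans lam1.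
have k0 : (0 <= k)%R by exact: le_trans k1.
(* The [8] is the [4] of [o] times the [2] of [chain]; [CA] and the power of [c] come from
   [lorentz_averages] with [m = c * V]. *)
exists (8 * k ^+ 2 * cP * CA / c `^ s^-1)%R.
  by rewrite divr_gt0 ?powR_gt0// !mulr_gt0//; exact: lt_le_trans k1.
move=> x r u G K r0 [mu_u iu] [bG G0 uG] Lfin KL.
set B2 := ball x (2 * lam * r); set V := fine (mu B2).
have lr0 : (0 < 2 * lam * r)%R by rewrite !mulr_gt0.
have V0 : (0 < V)%R by exact: fine_measure_ball_gt0.
pose f := G \_ B2.
have mf : measurable_fun setT f.
  apply/(measurable_restrictT _ (mB _ _)); apply: measurable_funTS.
  exact: borel_fun_measurable.
have f0 y : 0 <= f y by rewrite /f patchE; case: ifP.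
have [A [A0 AL Aav]] := hA d T mu f (c * V)%R mf f0 (mulr_gt0 c0 V0) Lfin.
set h := (2 `^ (- s))%R in Aav.
(* The scales start at [2 * r], so index 1 is the given ball. As [lam * rad i] is [2^{-i}] times the
   radius of [B2], the dimension condition gives measure at least [c V h^i], as [Aav] requires. *)
pose rad i := (2 * r / 2 ^+ i)%R.
have rad0 i : (0 < rad i)%R by rewrite divr_gt0 ?mulr_gt0 ?exprn_gt0.
have radS i : (2 * rad i.+1 = rad i)%R.
  by rewrite /rad exprS invfM; field; rewrite expf_neq0.
have rad1 : rad 1%N = r by rewrite /rad expr1; field.
have radr i : (rad i.+1 <= r)%R.
  elim: i => [|i IH]; first by rewrite rad1.
  by have := radS i.+1; have := rad0 i.+2; lra.
pose a y i := fine (average mu (ball y (rad i)) u).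
have aE y i : average mu (ball y (rad i)) u = (a y i)%:E.
  by rewrite fineK// average_fin_num ?measure_ball_gt0//; [exact: mB|exact: iu].
pose o i := (4 * cP * r * A i)%R.
have o0 i : (0 <= o i)%R by rewrite /o !mulr_ge0// ltW.
(* The diameter is at most [2 * rad i = 4 r 2^{-i}]; this cancels the factor [2^i] of [Aav] and
   leaves [o i]. *)
have osc y i : B2 y -> (lam * rad i <= 2 * lam * r)%R ->
    ball y (lam * rad i) `<=` B2 ->
    average mu (ball y (rad i)) (fun z => `|u z - (a y i)%:E|) <= (o i)%:E.
  move=> xy rle sub; rewrite -aE.
  apply: le_trans (hP y (rad i) u G (rad0 i) (conj mu_u iu) (And3 bG G0 uG)) _.
  have lri : (0 < lam * rad i)%R by rewrite mulr_gt0.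
  have : poweR (average mu (ball y (lam * rad i)) (fun z => poweR (f z) p)) p^-1
      <= (2 ^+ i * A i)%:E.
    apply: Aav; first exact: mB.
    rewrite measure_ball_lty// andbT.
    apply: le_trans (dimension_ball hmu hs lri rle xy).
    rewrite lee_fin -/B2 -/V le_eqVlt; apply/orP; left; apply/eqP.
    have -> : (lam * rad i / (2 * lam * r) = 2^-1 ^+ i)%R.
      rewrite /rad exprVn; field; rewrite ?expf_neq0//.
      by rewrite !gt_eqF.
    have -> : ((2^-1 ^+ i) `^ s = h ^+ i)%R.
      rewrite powR_exprAC ?invr_ge0//.
      by congr (_ ^+ _)%R; rewrite /h -powR_inv1// -powRrM mulN1r.
    by ring.
  have -> : average mu (ball y (lam * rad i)) (fun z => poweR (f z) p) =
      average mu (ball y (lam * rad i)) (fun z => poweR (G z) p).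
    congr (_ * _); apply: eq_integral => z /set_mem yz.
    by rewrite /f patchE mem_set//; exact: sub.
  move=> pA; apply: (@le_trans _ _ (cP%:E * (2 * rad i)%:E * (2 ^+ i * A i)%:E)).
    apply: lee_pmul => //; first last.
    - by rewrite lee_wpmul2l ?lee_fin ?(ltW cP0)//; exact: diam_ball.
    - exact: poweR_ge0.
    - rewrite mule_ge0 ?lee_fin ?(ltW cP0)//; apply: ereal_sup_ubound.
      exists (y, y); last by rewrite mdistxx.
      by split; exact: ballxx.
  rewrite -!EFinM lee_fin le_eqVlt; apply/orP; left; apply/eqP.
  by rewrite /o /rad; field; rewrite expf_neq0.
have step y i (D : set T) : B2 y -> (lam * rad i <= 2 * lam * r)%R ->
    ball y (lam * rad i) `<=` B2 -> measurable D -> D `<=` ball y (rad i) ->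
    0 < mu D -> mu (ball y (rad i)) <= (k ^+ 2)%:E * mu D ->
    `|average mu D u - (a y i)%:E| <= (k ^+ 2 * o i)%:E.
  move=> xy rle sub mD Dsub D0 kD.
  apply: (@average_sub_le _ _ _ _ D (ball y (rad i))) => //.
  - exact: mB.
  - exact: measure_ball_lty.
  - by rewrite exprn_ge0.
  - exact: iu.
  - exact: osc.
set uB := average mu (ball x r) u.
have uBE : uB = (a x 1%N)%:E by rewrite /uB -rad1 aE.
have k2k (D : set T) : k%:E * mu D <= (k ^+ 2)%:E * mu D.
  by rewrite lee_wpmul2r// lee_fin expr2 ler_peMl.
have xx0 : B2 x by exact: ballxx.
have lr2 : (lam * rad 0%N <= 2 * lam * r)%R by rewrite /rad expr0 divr1 mulrCA mulrA.
have sub0 : ball x (lam * rad 0%N) `<=` B2.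
  by apply: sub_ball; rewrite mdistxx add0r.
have a10 : (`|a x 1%N - a x 0%N| <= k ^+ 2 * o 0%N)%R.
  rewrite -lee_fin -abse_EFin EFinB -!aE [X in _ - X]aE; apply: step => //.
  - exact: mB.
  - by apply: sub_ball; rewrite mdistxx add0r -[X in (_ <= X)%R]radS; have := rad0 1%N; lra.
  - exact: measure_ball_gt0.
  - by apply: le_trans (k2k _); rewrite -(radS 0%N); exact: hk.
have By y : ball x r y -> B2 y.
  by apply: sub_ball; rewrite mdistxx add0r -mulrA; nra.
have suby y i : ball x r y -> ball y (lam * rad i.+1) `<=` B2.
  rewrite ballEmdist /= => xy; apply: sub_ball; have := radr i; nra.
have rady i : (lam * rad i.+1 <= 2 * lam * r)%R by have := radr i; nra.
(* The link between the centers is at the top scale: [ball y r] and [ball x r] both lie in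
   [ball x (2 * r)], which costs [k ^+ 2 * o 0] twice. Hence the factor 2; the finer scales
   telescope around [y]. *)
have chain y n : ball x r y ->
    (`|a y n.+1 - a x 1%N| <= 2 * k ^+ 2 * \sum_(i < n.+1) o i)%R.
  move=> xy; elim: n => [|n IH].
    rewrite big_ord_recl big_ord0 addr0.
    have h1 : (`|a y 1%N - a x 0%N| <= k ^+ 2 * o 0%N)%R.
      rewrite -lee_fin -abse_EFin EFinB -aE; apply: step => //.
      - exact: mB.
      - by move: xy; rewrite ballEmdist /= => xy; apply: sub_ball; rewrite rad1 /rad expr0; lra.
      - exact: measure_ball_gt0.
      (* [ball x (2 * r)] lies in [ball y (4 * r)]; the two doublings from there down to radius [r]
         account for the square of [k]. *)
      - have ry : (0 < 2 * r)%R by rewrite mulr_gt0.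
        apply: (@le_trans _ _ (mu (ball y (2 * (2 * r))))).
          apply: le_measure; rewrite ?inE; [exact: mB|exact: mB|].
          move: xy; rewrite ballEmdist /= => xy; apply: sub_ball.
          by rewrite metric_sym /rad expr0; lra.
        apply: le_trans (hk _ _ ry) _; rewrite expr2 EFinM -muleA.
        by rewrite lee_wpmul2l ?lee_fin// rad1; exact: hk.
    have := ler_normD (a y 1%N - a x 0%N)%R (a x 0%N - a x 1%N)%R.
    rewrite addrA subrK => /le_trans; apply.
    by rewrite -mulrA mulr2n mulrDl mul1r lerD// distrC.
  rewrite big_ord_recr/= mulrDr.
  have := ler_normD (a y n.+2 - a y n.+1)%R (a y n.+1 - a x 1%N)%R.
  rewrite addrA subrK => /le_trans; apply; rewrite addrC lerD//.
  apply: (@le_trans _ _ (k ^+ 2 * o n.+1)%R); last first.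
    by rewrite ler_wpM2r// ler_peMl ?exprn_ge0// ler1n.
  rewrite -lee_fin -abse_EFin EFinB -aE; apply: step => //.
  - exact: By.
  - exact: suby.
  - exact: mB.
  - by apply: sub_ball; rewrite mdistxx add0r -[X in (_ <= X)%R]radS; have := rad0 n.+2; lra.
  - exact: measure_ball_gt0.
  - by apply: le_trans (k2k _); rewrite -(radS n.+1); exact: hk.
pose l := fine (lorentz_norm mu s f).
have lE : lorentz_norm mu s f = l%:E by rewrite fineK// ge0_fin_numE// lorentz_norm_ge0// ltW.
have AL' n : (\sum_(i < n) A i <= CA / (c * V) `^ s^-1 * l)%R.
  by rewrite -lee_fin EFinM -lE.
have oK n : (2 * k ^+ 2 * \sum_(i < n) o i <= K)%R.
  move: KL; rewrite -/B2 -/V -/f lE -EFinM lee_fin; apply: le_trans.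
  rewrite /o -mulr_sumr.
  apply: (@le_trans _ _ (2 * k ^+ 2 * (4 * cP * r * (CA / (c * V) `^ s^-1 * l)))%R).
    by rewrite ler_wpM2l ?mulr_ge0 ?exprn_ge0// ler_wpM2l// !mulr_ge0// ltW.
  rewrite le_eqVlt; apply/orP; left; apply/eqP.
  rewrite powRM ?ltW//; field.
  by rewrite !gt_eqF ?powR_gt0.
set E := ball x r `&` _.
have mE : measurable E.
  apply: measurableI; first exact: mB.
  apply: measurable_superlevel; apply: measurableT_comp => //.
  by rewrite uBE; apply: emeasurable_funB.
(* The margin over [K] provides a positive threshold for Chebyshev's inequality; [E] is contained in
   the union of the [Ej j]. *)
pose Ej j := ball x r `&` [set y | (K + j.+1%:R^-1)%:E < `|u y - uB|].
have mEj j : measurable (Ej j).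
  apply: measurableI; first exact: mB.
  apply: measurable_superlevel; apply: measurableT_comp => //.
  by rewrite uBE; apply: emeasurable_funB.
suff Ej0 j : mu (Ej j) = 0.
  apply/negligibleP => //; apply: (@negligibleS _ _ _ mu (\bigcup_j Ej j)); last first.
    by apply: negligible_bigcup => j; exists (Ej j); split.
  move=> y [xy /=]; case uy: `|u y - uB| => [t| |]//.
    rewrite lte_fin -subr_gt0 => ty.
    have [n _ /(_ _ (leqnn n)) hn] := near_infty_natSinv_lt (PosNum ty).
    by exists n => //; split => //=; rewrite uy lte_fin -ltrBrDl.
  by move=> _; exists 0%N => //; split => //=; rewrite uy ltry.
pose e : R := (j.+1%:R^-1)%R.
have e0 : (0 < e :> R)%R by rewrite invr_gt0.
(* On [Ej j], [u] differs from [uB] by more than [K + e], while [a y n.+1] differs from it by at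
   most [K]; so [u] is at least [e] away from [a y n.+1]. Chebyshev's inequality is applied on each
   ball of the net and summed. *)
have small n : e%:E * mu (Ej j) <= (o n.+1)%:E * (k%:E * mu (ball x (2 * r))).
  have [t [tx cov tsum]] := finite_net hmu x hk c0 hs (rad0 n.+1) (radr n).
  apply: (@le_trans _ _ ((o n.+1)%:E * \sum_(y <- t) mu (ball y (rad n.+1)))); last first.
    by rewrite lee_wpmul2l// lee_fin.
  rewrite ge0_sume_distrr//.
  apply: (@le_trans _ _ (\sum_(y <- t) e%:E * mu (Ej j `&` ball y (rad n.+1)))).
    rewrite -ge0_sume_distrr// lee_wpmul2l ?lee_fin ?(ltW e0)//.
    apply: le_trans (@measure_bigsetU_le _ _ _ mu _
      (fun y => Ej j `&` ball y (rad n.+1)) t _); last first.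
      by move=> y; apply: measurableI => //; exact: mB.
    apply: le_measure; rewrite ?inE//.
      by apply: bigsetU_measurable => y _; apply: measurableI => //; exact: mB.
    move=> z [xz hz]; have := cov z xz; rewrite -!bigcup_seq => -[y yt yz].
    by exists y => //; split.
  rewrite big_seq [leRHS]big_seq; apply: lee_sum => y /tx xy.
  have H := osc y n.+1 (By _ xy) (rady n) (suby _ _ xy).
  have B0 := fine_measure_ball_gt0 hmu y (rad0 n.+1).
  rewrite /average (measure_ball_fine hmu y (rad0 n.+1)) inver gt_eqF// lee_pdivrMl// in H.
  rewrite (measure_ball_fine hmu y (rad0 n.+1)) muleC.
  apply: le_trans _ (le_trans H _); last by rewrite -!EFinM mulrC.
  have mua : measurable_fun setT (fun z => u z - (a y n.+1)%:E) by exact: emeasurable_funB.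
  apply: le_trans (le_integral_abse mu (mB _ _) (measurable_funTS mua) e0).
  rewrite muleC lee_wpmul2l ?lee_fin ?(ltW e0)//.
  apply: le_measure; rewrite ?inE.
  - by apply: measurableI => //; exact: mB.
  - apply: measurableI; first exact: mB.
    have : measurable_fun setT (fun z => `|u z - (a y n.+1)%:E|) by exact: measurableT_comp.
    move=> mau; rewrite -[X in measurable X]setTI; exact: emeasurable_fun_c_infty.
  move=> z [[xz hz] yz]; split => //=.
  have cn := chain y n xy; have oKn := oK n.+1.
  move: hz => /=; rewrite uBE; case: (u z) => [w| |]//=; rewrite ?leey//.
  rewrite lte_fin lee_fin -/e => hz.
  have := ler_normD (w - a y n.+1)%R (a y n.+1 - a x 1%N)%R.
  rewrite addrA subrK => hw; lra.
apply/eqP; rewrite eq_le measure_ge0 andbT; apply/lee_addgt0Pr => eta eta0.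
rewrite add0e.
have r20 : (0 < 2 * r)%R by rewrite mulr_gt0.
pose W := (k * vol x (2 * r))%R.
have W0 : (0 < W)%R by rewrite mulr_gt0 ?(lt_le_trans _ k1)// fine_measure_ball_gt0.
pose q := (4 * cP * r)%R.
have q0 : (0 < q)%R by rewrite !mulr_gt0.
have [n An] : exists n, (A n.+1 < eta * e / (q * W))%R.
  apply: bounded_sums_small A0 AL' _.
  by rewrite divr_gt0// mulr_gt0.
have := small n; rewrite (measure_ball_fine hmu x r20) -!EFinM -/W.
rewrite -lee_pdivlMl// => /le_trans; apply; rewrite -EFinM lee_fin.
rewrite ler_pdivrMl// [leRHS]mulrC /o -/q.
move: An; rewrite ltr_pdivlMr; last exact: mulr_gt0.
by move=> /ltW; rewrite mulrA [(A _ * q)%R]mulrC.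
Qed.

End ae_oscillation.

(** * Curves and line integrals *)

Section line_integrals.
Context {R : realType} {T : metricType R}.
Local Open Scope ereal_scope.

(** A [curve] starts at time 0, so its restriction to [[a, b]] has to be translated back. *)
Definition shift_fun (a : R) (f : R -> T) (y : R) : T := f (y + a)%R.

Lemma path_length_shift (a b c : R) (f : R -> T) :
  path_length a b (shift_fun c f) = path_length (a + c) (b + c) f.
Proof.
have polE l : polygonal_length a b (shift_fun c f) l =
    polygonal_length (a + c) (b + c) f [seq (y + c)%R | y <- l].
  rewrite /polygonal_length size_map; apply: eq_big_nat => i /andP[_ il] /=.
  rewrite (nth_map b)// -(map_cons (fun y => y + c)%R) /shift_fun.
  by rewrite (nth_map b)//= ltnS ltnW.
have pathE (x e : R) (l : seq R) :
    path (fun y z => y < z)%R (x + e)%R [seq (y + e)%R | y <- l] =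
    path (fun y z => y < z)%R x l.
  by elim: l x => //= y l IH x; rewrite ltrD2r IH.
have lastE (x e : R) (l : seq R) :
    last (x + e)%R [seq (y + e)%R | y <- l] = (last x l + e)%R.
  by elim: l x => //= y l IH x; rewrite IH.
rewrite /path_length; congr ereal_sup; apply/seteqP; split => _ [l [pl /eqP ll] <-].
  exists [seq (y + c)%R | y <- l]; last by rewrite polE.
  by split; [rewrite pathE|rewrite lastE ll].
exists [seq (y - c)%R | y <- l].
  split; first by rewrite -[a](addrK c) pathE.
  by rewrite -[a](addrK c) lastE ll addrK.
by rewrite polE -map_comp (eq_map (g := id)) ?map_id// => y /=; rewrite subrK.
Qed.

Section subcurve.
Variables (gamma : @curve R T) (a b : R).
Hypotheses (a0 : (0 <= a)%R) (ab : (a < b)%R) (bl : (b <= curve_len gamma)%R).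

Let len_gt0 : (0 < b - a)%R. Proof. by rewrite subr_gt0. Qed.

Let shift_continuous : {within `[0%R, (b - a)%R], continuous (shift_fun a gamma)}.
Proof.
apply/subspace_continuousP => x /=; rewrite in_itv/= => /andP[x0 xba].
have /subspace_continuousP := @curve_continuous R T gamma.
move=> /(_ (x + a)%R) /=.
rewrite in_itv/= => gc U xU.
have xa : ((0 <= x + a) && (x + a <= curve_len gamma))%R.
  by move: bl a0 x0 xba; lra.
have := gc xa U xU; rewrite !nbhs_filterE => -[e /= e0 He]; exists e => //= y xy.
rewrite in_itv/= => /andP[y0 yba]; apply: He => /=.
  by move: xy; rewrite /ball_ /= opprD addrACA subrr addr0.
by rewrite in_itv/=; move: bl a0 y0 yba; lra.
Qed.

Let shift_arclength c e : (0 <= c)%R -> (c <= e)%R -> (e <= b - a)%R ->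
  path_length c e (shift_fun a gamma) = (e - c)%:E.
Proof.
move=> c0 ce eba; rewrite path_length_shift.
have -> : (e - c = (e + a) - (c + a))%R by ring.
by apply: curve_arclength; move: bl a0; lra.
Qed.

Definition subcurve : @curve R T :=
  Curve len_gt0 shift_continuous shift_arclength.
End subcurve.

Lemma lebesgue_measure_shift (a : R) (A : set R) : measurable A ->
  pushforward lebesgue_measure ((fun y => y + a)%R : _ -> measurableTypeR R) A =
  lebesgue_measure A.
Proof.
move=> mA; apply/esym/lebesgue_measure_unique => //=.
  exact: measurable_funD.
move=> _ _ [[c e] _ <-] /=; rewrite /pushforward.
have -> : (fun y : R => (y + a)%R) @^-1` `]c, e]%classic = `](c - a)%R, (e - a)%R]%classic.
  by apply/seteqP; split => y /=; rewrite !in_itv/=; lra.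
rewrite !lebesgue_measure_itv/= !lte_fin ltrD2r; case: ifP => // _.
by rewrite -!EFinB; congr _%:E; ring.
Qed.

Lemma integral_shift (a c e : R) (f : R -> \bar R) :
  measurable_fun `[c, e] f -> (forall y, 0 <= f y) ->
  \int[lebesgue_measure]_(y in `[(c - a)%R, (e - a)%R]) f (y + a)%R =
  \int[lebesgue_measure]_(y in `[c, e]) f y.
Proof.
move=> mf f0.
have ms : measurable_fun setT ((fun y => y + a)%R : measurableTypeR R -> measurableTypeR R).
  exact: measurable_funD.
have -> : `[(c - a)%R, (e - a)%R]%classic =
    ((fun y => y + a)%R : measurableTypeR R -> measurableTypeR R) @^-1` `[c, e].
  by apply/seteqP; split => y /=; rewrite !in_itv/=; lra.
rewrite -[LHS](ge0_integral_pushforward ms lebesgue_measure _ mf)//=.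
apply/esym.
apply: (@eq_measure_integral _ _ _ _
  (measure_function_pushforward__canonical__measure_function_Measure
    lebesgue_measure ms)) => A mA AS.
exact/esym/lebesgue_measure_shift.
Qed.

End line_integrals.

(** An integrable [f] is finite almost everywhere, so it may be replaced by the real-valued [g], to
    which the absolute continuity of the integral applies. *)
Lemma integral_abs_continuous d (T : measurableType d) (R : realType)
    (mu : {measure set T -> \bar R}) (D : set T) (f : T -> \bar R) (e : R) :
  measurable D -> measurable_fun D f -> (forall x, 0 <= f x)%E ->
  (\int[mu]_(x in D) f x < +oo)%E -> 0 < e ->
  exists2 del : R, 0 < del & forall A, measurable A -> A `<=` D ->
    (mu A < del%:E)%E -> (\int[mu]_(x in A) f x < e%:E)%E.
Proof.
move=> mD mf f0 fy e0.
have iF : mu.-integrable D f.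
  apply/integrableP; split => //.
  by under eq_integral do rewrite gee0_abs//.
pose g x := fine ((f \_ D) x).
have mfD : measurable_fun setT (f \_ D) by apply/(measurable_restrictT _ mD).
have g0 x : 0 <= g x by rewrite fine_ge0// patchE; case: ifP.
have ae_g : {ae mu, forall x, D x -> f x = (g x)%:E}.
  apply: filterS (integrable_ae mD iF) => x h Dx.
  by rewrite /g patchE mem_set// fineK// h.
have mg : measurable_fun setT (EFin \o g).
  by apply/measurable_EFinP; apply: measurableT_comp mfD; exact: fine_measurable.
have gD x : ~ D x -> g x = 0 by move=> Dx; rewrite /g patchE memNset.
have ig : mu.-integrable setT (EFin \o g).
  apply/integrableP; split => //.
  under eq_integral do rewrite gee0_abs ?lee_fin//.
  apply: le_lt_trans fy.
  have -> : (\int[mu]_x (EFin \o g) x = \int[mu]_(x in D) (EFin \o g) x)%E.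
    rewrite [RHS]integral_mkcond; apply: eq_integral => x _.
    rewrite patchE; case: ifPn => // xD.
    by rewrite /= gD// => Dx; move: xD; rewrite mem_set.
  apply: ae_ge0_le_integral => //.
  - by move=> x _; rewrite lee_fin.
  - exact: measurable_funTS.
  - by apply: filterS ae_g => x h Dx; rewrite h.
have [del [del0 hdel]] := integral_normr_continuous ig e0.
exists del => // A mA AD mudel.
have := hdel A mA mudel; rewrite /Rintegral => h.
apply: (@le_lt_trans _ _ (\int[mu]_(x in A) (`|g x|)%:E)%E).
  apply: ae_ge0_le_integral => //.
  - exact: measurable_funS mf.
  - apply: measurable_funTS; apply/measurable_EFinP; apply: measurableT_comp => //.
    exact/measurable_EFinP.
  - by apply: filterS ae_g => x hx Ax; rewrite ger0_norm ?hx//; exact: AD.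
rewrite -[ltLHS]fineK ?lte_fin// ge0_fin_numE; last first.
  by apply: integral_ge0 => x _; rewrite lee_fin.
apply: (@le_lt_trans _ _ (\int[mu]_(x in setT) (`|g x|)%:E)%E).
  apply: ge0_subset_integral => //.
  by apply/measurable_EFinP; apply: measurableT_comp => //; exact/measurable_EFinP.
by case/integrableP: ig => _.
Qed.

Section curves.
Context {R : realType} {T : metricType R}.
Local Open Scope ereal_scope.
Implicit Type gamma : @curve R T.

(** The sets [A] with this property form a sigma-algebra, which contains the open sets because
    [gamma] is continuous on its interval. *)
Lemma measurable_curve_preimage gamma (A : set T) : <<s @open T >> A ->
  measurable (`[0%R, curve_len gamma] `&` gamma @^-1` A).
Proof.
pose D : set R := `[0%R, curve_len gamma]%classic.
have : <<s @open T >> `<=` [set A | measurable (D `&` gamma @^-1` A)].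
  apply: smallest_sub; last first.
    move=> U oU /=.
    have /continuousP/(_ U oU)/open_subspaceP[V oV VU] := @curve_continuous R T gamma.
    rewrite setIC -[X in measurable X]VU.
    by apply: measurableI; [exact: open_measurable|exact: measurable_itv].
  split.
  - by rewrite /= preimage_set0 setI0.
  - move=> B /= mB.
    rewrite setTD preimage_setC -setDE.
    have -> : D `\` gamma @^-1` B = D `\` (D `&` gamma @^-1` B).
      by apply/seteqP; split => x [? h]; split => // h'; apply: h; [case: h'|split].
    by apply: measurableD => //; exact: measurable_itv.
  - move=> F mF /=; rewrite preimage_bigcup setI_bigcupr.
    exact: bigcupT_measurable.
by apply.
Qed.


End curves.

Section borel_curves.
Context {R : realType} {d : measure_display} {T : metricMeasurableType R d}.
Local Open Scope ereal_scope.
Implicit Type gamma : @curve R T.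

Lemma measurable_fun_curve gamma (g : T -> \bar R) :
  borel_fun g ->
  measurable_fun `[0%R, curve_len gamma] (fun t : R => g (gamma t)).
Proof.
move=> mg mD Y mY.
rewrite (_ : _ @^-1` Y = gamma @^-1` (g @^-1` Y))//.
apply: measurable_curve_preimage; rewrite -[g @^-1` Y]setTI; exact: mg.
Qed.
Lemma upper_gradient_subcurve gamma (u g : T -> \bar R) (a b : R) :
  borel_fun g ->
  (forall x, 0 <= g x) -> (forall gamma, upper_gradient_on u g gamma) ->
  (0 <= a)%R -> (a < b)%R -> (b <= curve_len gamma)%R ->
  `|u (gamma a) - u (gamma b)| <=
    \int[lebesgue_measure]_(t in `[a, b]) g (gamma t).
Proof.
move=> mg g0 ug a0 ab bl.
have := ug (subcurve a0 ab bl); rewrite /upper_gradient_on /line_integral /=.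
rewrite /shift_fun add0r subrK => /le_trans; apply.
rewrite -(@integral_shift _ a a b (fun t => g (gamma t)))// ?subrr//.
apply: measurable_funS (measurable_fun_curve mg); first exact: measurable_itv.
by move=> x /=; rewrite !in_itv/=; move: bl a0; lra.
Qed.

End borel_curves.

(** * Exceptional sets of capacity zero *)

Section capacity.
Context {R : realType} {d : measure_display} {T : metricMeasurableType R d}.
Variable mu : {measure set T -> \bar R}.
Hypothesis hmu : borel_regular_measure mu.
Local Open Scope ereal_scope.

Lemma not_subset_null (A N : set R) : measurable A -> measurable N ->
  0 < lebesgue_measure A -> lebesgue_measure N = 0 ->
  exists2 t, A t & ~ N t.
Proof.
move=> mA mN A0 N0; apply: contrapT => h.
have : lebesgue_measure A <= lebesgue_measure N.
  apply: le_measure; rewrite ?inE// => t At; apply: contrapT => Nt.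
  by apply: h; exists t.
by rewrite N0 leNgt A0.
Qed.

(** On a short piece of [gamma] at either end the integral of [g] is below [e], so the upper
    gradient inequality on subcurves controls [u] there. The times spent in [N] form a null set, so
    the piece contains a time outside it. *)
Lemma curve_ends_approx (gamma : @curve R T) (u g : T -> \bar R) (N : set T) (e del : R) :
  borel_fun g -> (forall x, 0 <= g x) -> (forall gamma, upper_gradient_on u g gamma) ->
  borel_set N -> line_integral gamma g < +oo ->
  lebesgue_measure (`[0%R, curve_len gamma] `&` gamma @^-1` N) = 0 ->
  (0 < e)%R -> (0 < del)%R ->
  (exists t, [/\ (0 <= t < del)%R, (t <= curve_len gamma)%R, ~ N (gamma t)
     & `|u (gamma 0%R) - u (gamma t)| < e%:E]) /\
  (exists t, [/\ (curve_len gamma - del < t <= curve_len gamma)%R, (0 <= t)%R,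
     ~ N (gamma t) & `|u (gamma t) - u (gamma (curve_len gamma))| < e%:E]).
Proof.
move=> bg g0 ug bN gy N0 e0 del0; set l := curve_len gamma.
have l0 : (0 < l)%R := curve_len_gt0 gamma.
have mg := measurable_fun_curve (gamma := gamma) bg.
have [eta eta0 heta] := @integral_abs_continuous _ _ _ lebesgue_measure _ _ e
  (measurable_itv _) mg (fun t => g0 (gamma t)) gy e0.
pose m := Num.min (Num.min eta del) l.
have m0 : (0 < m)%R by rewrite !lt_min eta0 del0.
have [me [md ml]] : (m <= eta)%R /\ (m <= del)%R /\ (m <= l)%R.
  by rewrite /m !ge_min !lexx !orbT.
have mN := measurable_curve_preimage gamma bN.
have small a b : (0 <= a)%R -> (a < b)%R -> (b <= l)%R -> (b - a < m)%R ->
    `|u (gamma a) - u (gamma b)| < e%:E.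
  move=> a0 ab bl bam.
  apply: le_lt_trans (upper_gradient_subcurve bg g0 ug a0 ab bl) _.
  apply: heta; first exact: measurable_itv.
    by move=> t /=; rewrite !in_itv/= -/l; lra.
  suff : lebesgue_measure (`[a, b]%classic : set R) < eta%:E by [].
  by rewrite lebesgue_measure_itv/= lte_fin ab -EFinD lte_fin; lra.
split.
  have [t tm Nt] : exists2 t, `]0%R, m[%classic t & ~ (`[0%R, l] `&` gamma @^-1` N) t.
    apply: not_subset_null => //.
    suff : 0 < lebesgue_measure (`]0%R, m[%classic : set R) by [].
    by rewrite lebesgue_measure_itv/= lte_fin m0 -EFinD lte_fin subr0.
  move: tm; rewrite /= in_itv/= => /andP[t0 tm]; exists t; split; [lra|lra| |].
    by move=> Ngt; apply: Nt; split => //=; rewrite in_itv/=; lra.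
  by apply: small; lra.
have [t tm Nt] : exists2 t, `](l - m)%R, l[%classic t & ~ (`[0%R, l] `&` gamma @^-1` N) t.
  apply: not_subset_null => //.
  suff : 0 < lebesgue_measure (`](l - m)%R, l[%classic : set R) by [].
  by rewrite lebesgue_measure_itv/= lte_fin ltrBlDl ltrDr m0 -EFinD lte_fin; lra.
move: tm; rewrite /= in_itv/= => /andP[t0 tm]; exists t; split; [lra|lra| |].
  by move=> Ngt; apply: Nt; split => //=; rewrite in_itv/=; lra.
by apply: small; lra.
Qed.

Lemma curve_near (gamma : @curve R T) (B : set T) (a : R) :
  open B -> (0 <= a <= curve_len gamma)%R -> B (gamma a) ->
  exists2 del : R, (0 < del)%R & forall t, (0 <= t <= curve_len gamma)%R ->
    (`|t - a| < del)%R -> B (gamma t).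
Proof.
move=> oB al Ba.
have /subspace_continuousP := @curve_continuous R T gamma.
move=> /(_ a); rewrite /= in_itv/= => /(_ al) gc.
have : nbhs (gamma a) B by exact: open_nbhs_nbhs.
move=> /gc; rewrite !nbhs_filterE => -[e /= e0 He]; exists e => // t tl ta.
by apply: He => /=; rewrite ?in_itv//= distrC.
Qed.

Variable nX : (T -> \bar R) -> \bar R.
Hypothesis hX : quasi_banach_function_lattice mu nX.

Lemma upper_gradient_measurable (u g : T -> \bar R) :
  upper_gradient u g -> measurable_fun setT g.
Proof. by case=> bg _ _; exact: borel_fun_measurable hmu _ bg. Qed.

Lemma N1norm_ge0 (u : T -> \bar R) : measurable_fun setT u -> 0 <= N1norm nX u.
Proof.
move=> mu_u; rewrite /N1norm adde_ge0 ?(qnorm_ge0 hX)//.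
apply: le_ereal_inf_tmp => _ [g ug <-]; apply: (qnorm_ge0 hX).
exact: upper_gradient_measurable ug.
Qed.

Lemma in_N1_upper_gradient (u : T -> \bar R) : in_N1 nX u ->
  nX u < +oo /\ exists2 G, upper_gradient u G & nX G < +oo.
Proof.
move=> [mu_u]; rewrite /N1norm => uy.
have u0 := qnorm_ge0 hX mu_u.
have g0 : 0 <= ereal_inf [set nX g | g in upper_gradient u].
  apply: le_ereal_inf_tmp => _ [g ug <-]; apply: (qnorm_ge0 hX).
  exact: upper_gradient_measurable ug.
split; first by apply: le_lt_trans uy; rewrite leeDl.
have : ereal_inf [set nX g | g in upper_gradient u] < +oo.
  by apply: le_lt_trans uy; rewrite leeDr.
by move=> /ereal_inf_lt[_ [G uG <-]] Gy; exists G.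
Qed.

Lemma borel_restrict_cst (D : set T) (a : \bar R) : borel_set D ->
  borel_fun (cst a \_ D).
Proof.
move=> bD; rewrite /borel_fun.
by apply/(measurable_restrictT (T1 := g_sigma_algebraType (@open T)) _ bD); exact: measurable_cst.
Qed.

Lemma qnorm_restrict_null (D : set T) (a : \bar R) : measurable D -> mu D = 0 ->
  nX (cst a \_ D) = 0.
Proof.
move=> mD D0; apply/(qnorm_eq0 hX).
  by apply/(measurable_restrictT _ mD); exact: measurable_cst.
exists D; split => // x /= hx; apply: contrapT => Dx; apply: hx.
by rewrite patchE memNset.
Qed.

Lemma capacity_eq0 (u : T -> \bar R) (B : set T) (c K : R) :
  open B -> in_N1 nX u ->
  mu (B `&` [set y | K%:E < `|u y - c%:E|]) = 0 ->
  capacity nX (B `&` [set y | K%:E < `|u y - c%:E|]) = 0.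
Proof.
move=> oB N1u; set E := _ `&` _ => E0.
have [mu_u _] := N1u.
have [_ [G uG Gy]] := in_N1_upper_gradient N1u.
have [bG G0 uG'] := uG.
have [_ bm breg _] := hmu.
have mB : measurable B by apply: bm; exact: sub_sigma_algebra.
have mE : measurable E.
  apply: measurableI => //; apply: measurable_superlevel.
  by apply: measurableT_comp => //; exact: emeasurable_funB.
have [N [bN EN NE]] := breg E mE.
have mN : measurable N by exact: bm.
(* Infinite values on the Borel null set [N] keep [rho] Borel and of finite quasi-norm. *)
pose rho x := G x + (cst +oo \_ N) x.
have iN0 x : 0 <= (cst +oo \_ N : T -> \bar R) x.
  by rewrite patchE; case: ifP => _ //=; rewrite leey.
have brho : borel_fun rho.
  by apply: emeasurable_funD => //; exact: borel_restrict_cst.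
have rho0 x : 0 <= rho x by rewrite adde_ge0.
have mrho := borel_fun_measurable hmu brho.
have rhoy : nX rho < +oo.
  have [k [k1 tri _]] := qnorm_triangle_riesz_fischer hX.
  apply: le_lt_trans (tri _ _ (borel_fun_measurable hmu bG)
    (borel_fun_measurable hmu (borel_restrict_cst +oo bN))) _.
  rewrite qnorm_restrict_null ?NE// adde0.
  have := qnorm_ge0 hX (borel_fun_measurable hmu bG).
  by case: (nX G) Gy => [r| |]// _ _; rewrite -EFinM ltry.
pose chi := (cst 1 \_ E : T -> \bar R).
have mchi : measurable_fun setT chi.
  by apply/(measurable_restrictT _ mE); exact: measurable_cst.
(* If the integral were finite, [gamma] would spend almost no time in [N], and its end point in [E]
   would be approached by points outside [N] with nearby values of [u]. *)
have hit (gamma : @curve R T) : E (gamma 0%R) \/ E (gamma (curve_len gamma)) ->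
    line_integral gamma rho = +oo.
  move=> hE; apply: contrapT => /eqP; rewrite -ltey => rhogy.
  set l := curve_len gamma; have l0 : (0 < l)%R := curve_len_gt0 gamma.
  have Ggy : line_integral gamma G < +oo.
    by apply: le_lt_trans rhogy; apply: le_nonneg_integral => // t _; rewrite leeDl.
  have mA := measurable_curve_preimage gamma bN.
  have A0 : lebesgue_measure (`[0%R, l] `&` gamma @^-1` N) = 0.
    apply/eqP; rewrite eq_le measure_ge0 andbT leNgt; apply/negP => A0.
    move: rhogy; rewrite ltNge => /negP; apply.
    apply: (@le_trans _ _
      (\int[lebesgue_measure]_(t in `[0%R, l] `&` gamma @^-1` N) (cst +oo t))).
      by rewrite integral_cst// gt0_mulye.
    apply: (@le_trans _ _
      (\int[lebesgue_measure]_(t in `[0%R, l] `&` gamma @^-1` N) rho (gamma t))).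
      apply: le_nonneg_integral => [t _|t [_ /= Nt]]; first exact: leey.
      by rewrite /rho patchE mem_set//= addey// -ltNye (lt_le_trans _ (G0 _)).
    apply: ge0_subset_integral; [exact: mA|exact: measurable_itv| | |].
    - exact: measurable_fun_curve.
    - by move=> t _; exact: rho0.
    - exact: subIsetl.
  (* A point of [B] off [N] is off [E], so [|u - c| <= K] there, and close values of [u] force the
     same bound at [y]. If [u y] is infinite, no difference is below 1. *)
  have endpoint (y : T) : E y -> ~ (forall e : R, (0 < e)%R ->
      exists z, [/\ B z, ~ N z & `|u y - u z| < e%:E]).
    move=> [By /=]; case uy : (u y) => [w| |] hK happrox.
    - move: hK; rewrite lte_fin => hK.
      have e0 : (0 < `|w - c| - K)%R by rewrite subr_gt0.
      have [z [Bz Nz]] := happrox _ e0.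
      have : ~ E z by move=> /EN.
      move=> Ez; have : ~ (K%:E < `|u z - c%:E|) by move=> hz; apply: Ez; split.
      case: (u z) => [v| |]//=; rewrite ?ltry//.
      rewrite !lte_fin => /negP; rewrite -leNgt => hv hwv.
      have := ler_normD (w - v)%R (v - c)%R; rewrite addrA subrK; lra.
    - by have [z [_ _]] := happrox 1%R ltr01; case: (u z).
    - by have [z [_ _]] := happrox 1%R ltr01; case: (u z).
  case: hE => hE; apply: (endpoint _ hE) => e e0; have [Bend _] := hE.
    have [|del del0 hdel] := curve_near oB _ Bend; first by rewrite lexx ltW.
    have [[t [/andP[t0 td] tl Nt ut]] _] := curve_ends_approx bG G0 uG' bN Ggy A0 e0 del0.
    exists (gamma t); split => //; apply: hdel; first by rewrite t0.
    by rewrite subr0 ger0_norm.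
  have [|del del0 hdel] := curve_near oB _ Bend; first by rewrite lexx ltW.
  have [_ [t [/andP[td tl] t0 Nt ut]]] := curve_ends_approx bG G0 uG' bN Ggy A0 e0 del0.
  exists (gamma t); split => //; last first.
    by move: ut; case: (u _) => [?| |]; case: (u _) => [?| |]//=; rewrite distrC.
  apply: hdel; first by rewrite t0.
  by rewrite ler0_norm ?subr_le0// opprB; lra.
have ug_eps (e : R) : (0 < e)%R -> upper_gradient chi (fun x => e%:E * rho x).
  move=> e0; split.
  - exact: measurable_funeM.
  - by move=> x; rewrite mule_ge0// lee_fin ltW.
  move=> gamma; rewrite /upper_gradient_on.
  have lE : line_integral gamma (fun x => e%:E * rho x) = e%:E * line_integral gamma rho.
    rewrite /line_integral ge0_integralZl_EFin ?(ltW e0)//.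
    exact: measurable_fun_curve.
  (* If an end point lies in [E], the right-hand side is infinite by [hit]; otherwise [chi] vanishes
     at both ends. *)
  have [h|h] := pselect (E (gamma 0%R) \/ E (gamma (curve_len gamma))).
    by rewrite lE hit// gt0_muley ?lte_fin// leey.
  rewrite /chi !patchE !memNset.
  + rewrite subee// abse0; apply: integral_ge0 => t _.
    by rewrite mule_ge0// lee_fin ltW.
  + by move=> hE; apply: h; right.
  + by move=> hE; apply: h; left.
apply/eqP; rewrite eq_le; apply/andP; split; last first.
  by apply: le_ereal_inf_tmp => _ [v [mv _] <-]; exact: N1norm_ge0.
apply/lee_addgt0Pr => e e0; rewrite add0e.
apply: (@le_trans _ _ (N1norm nX chi)).
  apply: ereal_inf_lbound; exists chi => //; split => // x Ex.
  by rewrite /chi patchE mem_set.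
rewrite /N1norm qnorm_restrict_null// add0e.
have rho0' := qnorm_ge0 hX mrho.
pose r := fine (nX rho).
have rE : nX rho = r%:E by rewrite fineK// ge0_fin_numE.
have r0 : (0 <= r)%R by rewrite -lee_fin -rE.
(* The denominator [r + 1] stays positive when [r = 0]. *)
have q0 : (0 < e / (r + 1))%R by rewrite divr_gt0// ltr_wpDl.
apply: (@le_trans _ _ (nX (fun x => (e / (r + 1))%:E * rho x))).
  by apply: ereal_inf_lbound; exists (fun x => (e / (r + 1))%:E * rho x) => //; exact: ug_eps.
rewrite (qnormZ hX)// rE ger0_norm ?(ltW q0)// -EFinM lee_fin.
rewrite -mulrA ler_piMr ?(ltW e0)// ler_pdivrMl ?ltr_wpDl// mulr1; lra.
Qed.

End capacity.

(** * Weak upper gradients *)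

Section weak_upper_gradients.
Context {R : realType} {d : measure_display} {T : metricMeasurableType R d}.
Variable mu : {measure set T -> \bar R}.
Hypothesis hmu : borel_regular_measure mu.
Local Open Scope ereal_scope.

(** Regularity gives a Borel set of equal measure, and the difference is null once that measure is
    finite; so [A] is first cut into pieces of finite measure. *)
Lemma borel_hull (A : set T) : measurable A ->
  exists D, [/\ borel_set D, A `<=` D & mu (D `\` A) = 0].
Proof.
have [[F FT hF] bm breg _] := hmu; move=> mA.
have mAF n : measurable (A `&` F n) by apply: measurableI => //; case: (hF n).
have /choice[D hD] : forall n, exists D : set T,
    [/\ borel_set D, A `&` F n `<=` D & mu D = mu (A `&` F n)].
  by move=> n; exact: breg.
have mD n : measurable (D n) by apply: bm; case: (hD n).
have bU : borel_set (\bigcup_n D n).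
  by apply: (@bigcupT_measurable _ (g_sigma_algebraType (@open T))) => n; case: (hD n).
exists (\bigcup_n D n); split => //.
  move=> x Ax; have : [set: T] x by [].
  by rewrite FT => -[n _ Fx]; exists n => //; case: (hD n) => _ + _; apply.
apply/negligibleP; first by apply: measurableD => //; exact: bm.
apply: (@negligibleS _ _ _ mu (\bigcup_n (D n `\` (A `&` F n)))).
  by move=> x [[n _ Dx] Ax]; exists n => //; split => // -[].
apply: negligible_bigcup => n; exists (D n `\` (A `&` F n)); split => //.
  exact: measurableD.
have [_ AD DE] := hD n.
have fy : mu (A `&` F n) < +oo.
  by case: (hF n) => mF; apply: le_lt_trans; apply: le_measure; rewrite ?inE.
have Dy : mu (D n) < +oo by rewrite DE.
rewrite measureD// setIidr//.
transitivity (mu (A `&` F n) - mu (A `&` F n)); first by congr (_ - _).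
by rewrite subee// ge0_fin_numE.
Qed.

Lemma rat_between (r : R) (y : \bar R) : r%:E < y ->
  exists q : rat, (r < ratr q)%R /\ (ratr q)%:E < y.
Proof.
case: y => [y| |]//; rewrite ?lte_fin => ry.
  by have [q] := rat_in_itvoo ry; rewrite in_itv/= => /andP[rq qy]; exists q.
have [q] := @rat_in_itvoo R r (r + 1)%R ltac:(by rewrite ltrDl).
by rewrite in_itv/= => /andP[rq _]; exists q; rewrite ltry.
Qed.

Lemma borel_funP (f : T -> \bar R) :
  (forall r : R, borel_set [set x | r%:E < f x]) -> borel_fun f.
Proof.
move=> hf.
apply: (measurability _ (ErealGenOInfty.measurableE R)) => //.
move=> _ [_ [r ->] <-]; rewrite setTI.
have -> : f @^-1` `]r%:E, +oo[ = [set x | r%:E < f x].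
  by apply/seteqP; split => x /=; rewrite in_itv/= andbT.
exact: hf.
Qed.

(** Each rational superlevel set gets a Borel hull, and a Borel null set [Z] contains all the excess
    sets. [G] is infinite on [Z] and equals [g] elsewhere; outside [Z] the sets [D q] and [A q]
    agree, so the superlevel sets of [G] are Borel. *)
Lemma borel_majorant (g : T -> \bar R) : measurable_fun setT g ->
  exists G : T -> \bar R, [/\ borel_fun G, (forall x, g x <= G x)
    & {ae mu, forall x, G x = g x}].
Proof.
have [_ bm breg _] := hmu; move=> mg.
pose A (q : rat) := [set x | (ratr q)%:E < g x].
have mA q : measurable (A q) by exact: measurable_superlevel.
have /choice[D hD] : forall q, exists D : set T,
    [/\ borel_set D, A q `<=` D & mu (D `\` A q) = 0].
  by move=> q; exact: borel_hull.
have bD q : borel_set (D q) by case: (hD q).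
have mDA q : measurable (D q `\` A q) by apply: measurableD => //; exact: bm.
have mZ0 : measurable (\bigcup_q (D q `\` A q)) by exact: bigcupT_measurable_rat.
have [Z [bZ Z0Z muZ]] := breg _ mZ0.
have Z0 : mu Z = 0.
  rewrite muZ; apply/negligibleP => //.
  have [e [ef fe]] : exists e : nat -> rat, exists f, cancel f e.
    exists (fun n => odflt 0%R (unpickle n)); exists pickle => q.
    by rewrite pickleK.
  apply: (@negligibleS _ _ _ mu (\bigcup_n (D (e n) `\` A (e n)))).
    by move=> x [q _ hx]; exists (ef q) => //; rewrite fe.
  apply: negligible_bigcup => n; exists (D (e n) `\` A (e n)); split => //.
  by case: (hD (e n)).
exists (fun x => if x \in Z then +oo else g x); split.
- apply: borel_funP => r.
  have -> : [set x | r%:E < (if x \in Z then +oo else g x)] =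
      Z `|` \bigcup_(q : rat) (if (r < ratr q)%R then D q `\` Z else set0).
    apply/seteqP; split => x /=.
      case: ifPn => [/set_mem|xZ rg]; first by left.
      right; have [q [rq qg]] := rat_between rg; exists q => //; rewrite rq.
      split; first by case: (hD q) => _ + _; apply.
      by move=> /mem_set; apply/negP.
    case=> [Zx|[q _]]; first by rewrite mem_set// ltry.
    case: ifPn => // rq [Dx Zx]; rewrite memNset//.
    apply: (@lt_trans _ _ (ratr q)%:E); first by rewrite lte_fin.
    by apply: contrapT => Ax; apply: Zx; apply: Z0Z; exists q.
  apply: (@measurableU _ (g_sigma_algebraType (@open T))) => //.
  apply: (@bigcupT_measurable_rat _ (g_sigma_algebraType (@open T))) => q.
  case: ifPn => _; last exact: (@measurable0 _ (g_sigma_algebraType (@open T))).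
  by apply: (@measurableD _ (g_sigma_algebraType (@open T))); [exact: bD|exact: bZ].
- by move=> x; case: ifP; rewrite ?leey.
- exists Z; split => //; first exact: bm.
  by move=> x /= hx; apply: contrapT => Zx; apply: hx; rewrite memNset.
Qed.

Variable nX : (T -> \bar R) -> \bar R.
Hypothesis hX : quasi_banach_function_lattice mu nX.

(** On an exceptional curve every positive multiple of [rho] has infinite integral; on the other
    curves the inequality for [g] passes to larger functions. *)
Lemma weak_upper_gradient_approx (u g G : T -> \bar R) :
  weak_upper_gradient nX u g -> borel_fun G -> (forall x, g x <= G x) ->
  exists rho : T -> \bar R, [/\ (forall x, 0 <= rho x), in_X nX rho
    & forall n, upper_gradient u (fun x => G x + (n.+1%:R^-1)%:E * rho x)].
Proof.
move=> [mg g0 [rho [brho rho0 Xrho hrho]]] bG gG; exists rho; split => // n.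
have n0 : (0 < (n.+1%:R^-1 : R))%R by rewrite invr_gt0.
have G0 x : 0 <= G x by exact: le_trans (g0 x) (gG x).
have r0 x : 0 <= (n.+1%:R^-1)%:E * rho x by rewrite mule_ge0// lee_fin ltW.
split.
- by apply: emeasurable_funD => //; exact: measurable_funeM.
- by move=> x; rewrite adde_ge0.
move=> gamma; have [h|h] := pselect (upper_gradient_on u g gamma).
  apply: le_trans h _; apply: le_nonneg_integral => // t _.
  by apply: le_trans (gG _) _; rewrite leeDl.
have /hrho ry := h.
rewrite /upper_gradient_on (_ : line_integral _ _ = +oo) ?leey//.
apply/eqP; rewrite -leye_eq.
apply: (@le_trans _ _ ((n.+1%:R^-1)%:E * line_integral gamma rho)).
  by rewrite ry gt0_muley// lte_fin.
rewrite /line_integral -ge0_integralZl_EFin ?(ltW n0)//.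
  by apply: le_nonneg_integral => // t _; rewrite leeDr.
exact: measurable_fun_curve.
Qed.

(** On the set [N] where [f] is infinite, [|f|] dominates every constant [n]; hence [n] times the
    quasi-norm of the indicator of [N] is bounded, and this quasi-norm is 0. *)
Lemma qnorm_ae_fin (f : T -> \bar R) : in_X nX f ->
  {ae mu, forall x, f x \is a fin_num}.
Proof.
move=> [mf fy]; pose N := [set x | `|f x| = +oo].
have mN : measurable N.
  have -> : N = f @^-1` [set -oo; +oo].
    apply/seteqP; split => x; rewrite /N /=; last by move=> [|] ->.
    by case: (f x) => [r| |]//= _; [right|left].
  rewrite -[_ @^-1` _]setTI; apply: mf => //.
  by apply: measurableU; exact: emeasurable_set1.
pose chi := (cst 1 \_ N : T -> \bar R).
have mchi : measurable_fun setT chi.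
  by apply/(measurable_restrictT _ mN); exact: measurable_cst.
have chin n : n%:R%:E * nX chi <= nX f.
  rewrite -[X in X%:E * _](@ger0_norm R n%:R)// -(qnormZ hX)//.
  apply: (qnorm_lattice hX) => //; first exact: measurable_funeM.
  apply: aeW => x; rewrite /chi patchE; case: ifPn => [/set_mem ->|_]; first exact: leey.
  by rewrite mule0 abse0.
have chi0 : nX chi = 0.
  have c0 := qnorm_ge0 hX mchi; have f0 := qnorm_ge0 hX mf.
  apply/eqP; rewrite eq_le c0 andbT.
  have fE : nX f = (fine (nX f))%:E by rewrite fineK// ge0_fin_numE.
  have cE : nX chi = (fine (nX chi))%:E.
    by rewrite fineK// ge0_fin_numE//; apply: le_lt_trans fy; have := chin 1%N; rewrite mul1e.
  rewrite leNgt; apply/negP; rewrite cE lte_fin => cpos.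
  have := chin (Num.trunc (fine (nX f) / fine (nX chi))).+1.
  rewrite cE fE -EFinM lee_fin -ler_pdivlMr// leNgt => /negP; apply.
  exact: truncnS_gt.
have /(qnorm_eq0 hX mchi) := chi0.
apply: filterS => x; rewrite /chi patchE; case: ifPn => [_ /eqP|/negP xN _].
  by rewrite onee_eq0.
rewrite -abse_fin_num ge0_fin_numE// lt_neqAle leey andbT.
by apply/eqP => h; apply: xN; rewrite mem_set.
Qed.

Lemma in_X_restrict (f : T -> \bar R) (B : set T) : measurable B ->
  in_X nX f -> in_X nX (f \_ B).
Proof.
move=> mB [mf fy]; have mfB : measurable_fun setT (f \_ B).
  by apply/(measurable_restrictT _ mB); exact: measurable_funTS.
split => //; apply: le_lt_trans fy; apply: (qnorm_lattice hX) => //.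
by apply: aeW => x; rewrite patchE; case: ifP => _ //; rewrite abse0.
Qed.

(** Where [G] is finite, hence almost everywhere, the difference of the two functions is at most
    [rho / (n + 1)]; its quasi-norm tends to 0, and the continuity of the quasi-norm applies. *)
Lemma qnorm_perturbation (G rho : T -> \bar R) (B : set T) : measurable B ->
  in_X nX G -> in_X nX rho -> (forall x, 0 <= rho x) ->
  nX ((fun x => G x + (n.+1%:R^-1)%:E * rho x) \_ B) @[n --> \oo] --> nX (G \_ B).
Proof.
move=> mB XG Xrho rho0; have [mG Gy] := XG; have [mrho rhoy] := Xrho.
have mGn n : measurable_fun setT (fun x => G x + (n.+1%:R^-1)%:E * rho x).
  by apply: emeasurable_funD => //; exact: measurable_funeM.
have mr (f : T -> \bar R) : measurable_fun setT f -> measurable_fun setT (f \_ B).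
  by move=> mf; apply/(measurable_restrictT _ mB); exact: measurable_funTS.
apply: (qnorm_continuous hX); [by move=> n; exact: mr|exact: mr|].
have mdiff n : measurable_fun setT (fun x =>
    ((fun x => G x + (n.+1%:R^-1)%:E * rho x) \_ B) x - (G \_ B) x).
  by apply: emeasurable_funB; exact: mr.
have rho_ge0 := qnorm_ge0 hX mrho.
have rE : nX rho = (fine (nX rho))%:E by rewrite fineK// ge0_fin_numE.
apply: (@squeeze_cvge _ _ _ _ (cst 0) _ (fun n => (n.+1%:R^-1 * fine (nX rho))%:E)).
- apply: nearW => n; rewrite (qnorm_ge0 hX)//=.
  rewrite EFinM -rE -[X in X%:E * _](@ger0_norm R) ?invr_ge0// -(qnormZ hX)//.
  apply: (qnorm_lattice hX) => //; first exact: measurable_funeM.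
  apply: filterS (qnorm_ae_fin XG) => x Gx; rewrite !patchE; case: ifPn => _.
    by rewrite addeAC subee// add0e.
  by rewrite subee// abse0.
- exact: cvg_cst.
- apply: cvg_EFin; first exact: nearW.
  rewrite -[X in _ --> X](mul0r (fine (nX rho))).
  by apply: cvgMl; exact: cvg_harmonic.
Qed.

End weak_upper_gradients.

(** * Embedding constants and conclusion *)

Section embeddings.
Context {R : realType} {d : measure_display} {T : metricMeasurableType R d}.
Variable mu : {measure set T -> \bar R}.
Hypothesis hmu : borel_regular_measure mu.
Variable nX : (T -> \bar R) -> \bar R.
Hypothesis hX : quasi_banach_function_lattice mu nX.
Variables (s : R) (cemb : T -> R -> R).
Hypothesis s1 : (1 < s)%R.
Hypothesis hemb : embeds_Lorentz_loc mu nX s cemb.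
Local Open Scope ereal_scope.
Local Notation mB := (measurable_metric_ball hmu).
Local Notation vol x r := (fine (mu (ball x r))).

Lemma embedding_gt0 (x : T) (r : R) : (0 < r)%R -> (0 < cemb x r)%R.
Proof. by move=> r0; have [[]] := hemb x r0. Qed.

Lemma embedding_lorentz (x : T) (r : R) (u : T -> \bar R) : (0 < r)%R ->
  measurable_fun setT u ->
  lorentz_norm mu s (u \_ (ball x r)) <= (cemb x r)%:E * nX (u \_ (ball x r)).
Proof. by move=> r0; have [[_ +] _] := hemb x r0; exact. Qed.

Lemma embedding_lorentz_lty (x : T) (r : R) (u : T -> \bar R) : (0 < r)%R ->
  in_X nX u -> lorentz_norm mu s (u \_ (ball x r)) < +oo.
Proof.
move=> r0 Xu; apply: le_lt_trans (embedding_lorentz x r0 Xu.1) _.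
have [mu_u uy] := in_X_restrict hX (mB x r) Xu.
have := qnorm_ge0 hX mu_u.
by case: (nX _) uy => [v| |]// _ _; rewrite -EFinM ltry.
Qed.

(** The constant of the larger ball is admissible for the smaller one, since a function cut off to
    the smaller ball is unchanged by the second cut-off; minimality of [cemb] concludes. *)
Lemma le_embedding (x y : T) (r r' : R) : (0 < r)%R -> (0 < r')%R ->
  ball x r `<=` ball y r' -> (cemb x r <= cemb y r')%R.
Proof.
move=> r0 r'0 sub; have [_] := hemb x r0; apply; split; first exact: embedding_gt0.
move=> u mu_u.
have -> : u \_ (ball x r) = (u \_ (ball x r)) \_ (ball y r').
  apply/funext => z; rewrite [RHS]patchE; case: ifPn => // /negP zy.
  by rewrite patchE memNset// => /sub /mem_set.
apply: embedding_lorentz => //.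
by apply/(measurable_restrictT _ (mB _ _)); exact: measurable_funTS.
Qed.

(** The mean of [|u|] over the ball is bounded by [lorentz_averages] with exponent 1, at index 0 and
    with [m] the measure of the ball; this uses [1 < s]. *)
Lemma in_X_L1loc (u : T -> \bar R) : in_X nX u -> L1loc mu u.
Proof.
move=> Xu; have [mu_u uy] := Xu; split => // x r r0.
apply/integrableP; split; first exact: measurable_funTS.
pose f := (fun y => `|u y|) \_ (ball x r).
have mau : measurable_fun setT (fun y => `|u y|) by exact: measurableT_comp.
have Xau : in_X nX (fun y => `|u y|).
  split => //; apply: le_lt_trans uy; apply: (qnorm_lattice hX) => //.
  by apply: aeW => y; rewrite abse_id.
have mf : measurable_fun setT f.
  by apply/(measurable_restrictT _ (mB _ _)); exact: measurable_funTS.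
have f0 y : 0 <= f y by rewrite /f patchE; case: ifP.
have [C C0 hC] := lorentz_averages (lexx 1%R) s1.
have [A [_ _ hA]] := hC d T mu f _ mf f0 (fine_measure_ball_gt0 hmu x r0)
  (embedding_lorentz_lty x r0 Xau).
have {hA} := hA 0%N _ (mB x r).
rewrite expr0 mulr1 -(measure_ball_fine hmu x r0) lexx measure_ball_lty// => /(_ isT).
rewrite invr1 poweRe1; last first.
  rewrite /average mule_ge0 ?inve_ge0 ?measure_ge0//.
  by apply: integral_ge0 => y _; exact: poweR_ge0.
rewrite /average (measure_ball_fine hmu x r0) inver gt_eqF ?fine_measure_ball_gt0//.
rewrite lee_pdivrMl ?fine_measure_ball_gt0// -EFinM.
have -> : \int[mu]_(y in ball x r) poweR (f y) 1 = \int[mu]_(y in ball x r) `|u y|.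
  by apply: eq_integral => y yB; rewrite poweRe1// /f patchE yB.
by move=> h; apply: le_lt_trans h _; rewrite ltry.
Qed.

(** By the dimension condition, the [1/s]-th power of the measure of the small ball is at least a
    multiple of [r], which cancels the [r] of the numerator; the embedding constants are
    monotone. *)
Lemma ball_factor_le (lam c P : R) (x x0 : T) (r : R) :
  (0 < c)%R ->
  (forall (x y : T) (r rho : R), (0 < r)%R -> (r <= rho)%R -> ball x rho y ->
      (c * (r / rho) `^ s)%:E <= mu (ball y r) / mu (ball x rho)) ->
  (0 < lam)%R -> (0 < r)%R -> (2 * lam * r <= P)%R -> ball x0 P x ->
  ball x (2 * lam * r) `<=` ball x0 P ->
  (ball_factor mu s lam cemb x r <=
    (c `^ s^-1)^-1 * (cemb x0 P * (P / (2 * lam)) / (vol x0 P) `^ s^-1))%R.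
Proof.
move=> c0 hs lam0 r0 rP xP sub.
have s0 : (0 < s)%R by rewrite (lt_trans _ s1).
have lr0 : (0 < 2 * lam * r)%R by rewrite !mulr_gt0.
have P0 : (0 < P)%R by exact: lt_le_trans rP.
have vx := fine_measure_ball_gt0 hmu x lr0.
have v0 := fine_measure_ball_gt0 hmu x0 P0.
have q0 : (0 < 2 * lam * r / P)%R by rewrite divr_gt0.
have hv : (c `^ s^-1 * (2 * lam * r / P) * (vol x0 P) `^ s^-1 <=
    (vol x (2 * lam * r)) `^ s^-1)%R.
  have h := dimension_ball hmu hs lr0 rP xP.
  have [t [tE t0]] : exists t, (2 * lam * r / P)%R = t /\ (0 < t)%R by eexists.
  rewrite tE in h *.
  have {}h : (c * t `^ s * vol x0 P <= vol x (2 * lam * r))%R.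
    by rewrite -lee_fin -(measure_ball_fine hmu x lr0).
  have ct0 : (0 <= c * t `^ s)%R by rewrite mulr_ge0 ?powR_ge0 ?(ltW c0).
  have -> : (c `^ s^-1 * t * vol x0 P `^ s^-1 = (c * t `^ s * vol x0 P) `^ s^-1)%R.
    rewrite !powRM ?powR_ge0 ?(ltW c0) ?(ltW v0)//.
    by rewrite -[in RHS]powRrM mulfV ?gt_eqF// powRr1 ?(ltW t0).
  apply: ge0_ler_powR h; rewrite ?nnegrE ?invr_ge0 ?(ltW s0) ?(ltW vx)//.
  by rewrite mulr_ge0// ltW.
have e0 : (0 < c `^ s^-1)%R by rewrite powR_gt0.
have w0 : (0 < vol x0 P `^ s^-1)%R by rewrite powR_gt0.
have wx : (0 < vol x (2 * lam * r) `^ s^-1)%R by rewrite powR_gt0.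
have cx := embedding_gt0 x lr0.
have cle : (cemb x (2 * lam * r) <= cemb x0 P)%R by exact: le_embedding.
rewrite /ball_factor ler_pdivrMr//.
apply: (@le_trans _ _ (cemb x0 P * r)%R); first by rewrite ler_wpM2r// ltW.
have cP := lt_le_trans cx cle.
have -> : (cemb x0 P * r =
   ((c `^ s^-1)^-1 * (cemb x0 P * (P / (2 * lam)) / vol x0 P `^ s^-1)) *
   (c `^ s^-1 * (2 * lam * r / P) * vol x0 P `^ s^-1))%R.
  by field; rewrite !gt_eqF.
have K0 : (0 < (c `^ s^-1)^-1 * (cemb x0 P * (P / (2 * lam)) / vol x0 P `^ s^-1))%R.
  apply: mulr_gt0; first by rewrite invr_gt0.
  by apply: divr_gt0 => //; apply: mulr_gt0 => //; apply: divr_gt0 => //; exact: mulr_gt0.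
by rewrite ler_wpM2l// ltW.
Qed.

Lemma ball_factor_gt0 (lam : R) (x : T) (r : R) : (0 < lam)%R -> (0 < r)%R ->
  (0 < ball_factor mu s lam cemb x r)%R.
Proof.
move=> lam0 r0; have lr0 : (0 < 2 * lam * r)%R by rewrite !mulr_gt0.
by rewrite /ball_factor divr_gt0 ?mulr_gt0 ?embedding_gt0 ?powR_gt0 ?fine_measure_ball_gt0.
Qed.

Lemma cap_ess_sup_oscillation (p lam : R) :
  doubling mu -> dimension_condition mu s -> poincare mu p lam ->
  (1 <= p)%R -> (p < s)%R -> (1 <= lam)%R ->
  exists2 C : R, (0 < C)%R & forall (x : T) (r : R) (u g : T -> \bar R),
    (0 < r)%R -> in_N1 nX u -> in_X nX g -> weak_upper_gradient nX u g ->
    cap_ess_sup nX (ball x r) (fun y => `|u y - average mu (ball x r) u|) <=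
      (C * ball_factor mu s lam cemb x r)%:E * nX (g \_ (ball x (2 * lam * r))).
Proof.
move=> hdbl hs hPI p1 ps lam1.
have lam0 : (0 < lam)%R by exact: lt_le_trans lam1.
have [C C0 hC] := ae_oscillation_bound hmu hdbl hs hPI p1 ps lam1.
exists C => // x r u g r0 N1u Xg wug.
have lr0 : (0 < 2 * lam * r)%R by rewrite !mulr_gt0.
set B2 := ball x (2 * lam * r).
have [uy _] := in_N1_upper_gradient hmu hX N1u.
have [mu_u _] := N1u; have L1u := in_X_L1loc (conj mu_u uy).
have [mg gy] := Xg.
have [G [bG gG aeG]] := borel_majorant hmu mg.
have mG := borel_fun_measurable hmu bG.
have XG : in_X nX G.
  split => //; apply: le_lt_trans gy; apply: (qnorm_lattice hX) => //.
  by apply: filterS aeG => y ->.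
have [rho [rho0 Xrho ugn]] := weak_upper_gradient_approx wug bG gG.
(* These are genuine upper gradients of [u], and their quasi-norms over [B2] tend to that of [g]. *)
pose Gn n y := G y + (n.+1%:R^-1)%:E * rho y.
have cvG := qnorm_perturbation hX (mB x (2 * lam * r)) XG Xrho rho0.
have nGg : nX (G \_ B2) = nX (g \_ B2).
  have mG2 := (in_X_restrict hX (mB x (2 * lam * r)) XG).1.
  have mg2 := (in_X_restrict hX (mB x (2 * lam * r)) Xg).1.
  apply/eqP; rewrite eq_le; apply/andP; split; apply: (qnorm_lattice hX) => //.
    by apply: filterS aeG => y Gy; rewrite !patchE; case: ifP; rewrite ?Gy.
  by apply: filterS aeG => y Gy; rewrite !patchE; case: ifP; rewrite ?Gy.
have [mg2 g2y] := in_X_restrict hX (mB x (2 * lam * r)) Xg.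
have g20 := qnorm_ge0 hX mg2.
pose b := fine (nX (g \_ B2)).
have bE : nX (g \_ B2) = b%:E by rewrite fineK// ge0_fin_numE.
rewrite -/B2 bE -EFinM.
set F := (C * ball_factor mu s lam cemb x r)%R.
have F0 : (0 < F)%R by rewrite mulr_gt0// ball_factor_gt0.
have avE : average mu (ball x r) u = (fine (average mu (ball x r) u))%:E.
  rewrite fineK// average_fin_num ?measure_ball_gt0//; first exact: mB.
  exact: L1u.2.
(* The slack [e] absorbs the perturbation: once the quasi-norm of [Gn n] over [B2] is below
   [b + e / F], the oscillation bound is at most [F * b + e]. *)
apply/lee_addgt0Pr => e e0; rewrite -EFinD.
apply: ereal_inf_lbound; exists (F * b + e)%R => //=.
rewrite avE; apply: (capacity_eq0 hmu hX _ N1u); first exact: open_metric_ball.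
have [n hn] : exists n, nX (Gn n \_ B2) < (b + e / F)%:E.
  have : nX (G \_ B2) < (b + e / F)%:E.
    by rewrite nGg bE lte_fin ltrDl divr_gt0.
  move=> h; have := cvG _ (open_ereal_lt_ereal h).
  by case=> n _ /(_ _ (leqnn n)) hn; exists n.
have uG : upper_gradient u (Gn n) := ugn n.
have mGn : measurable_fun setT (Gn n) := upper_gradient_measurable hmu uG.
have lor := embedding_lorentz x lr0 mGn.
have cb0 := embedding_gt0 x lr0.
have mGn2 : measurable_fun setT (Gn n \_ B2).
  by apply/(measurable_restrictT _ (mB _ _)); exact: measurable_funTS.
have Gn0 := qnorm_ge0 hX mGn2.
have GnE : nX (Gn n \_ B2) = (fine (nX (Gn n \_ B2)))%:E.
  by rewrite fineK// ge0_fin_numE// (lt_trans hn)// ltry.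
rewrite -avE; apply: (hC x r u (Gn n)) => //.
  by apply: le_lt_trans lor _; rewrite GnE -EFinM ltry.
apply: (@le_trans _ _ ((C * r / vol x (2 * lam * r) `^ s^-1)%:E *
    ((cemb x (2 * lam * r))%:E * nX (Gn n \_ B2)))).
  rewrite lee_wpmul2l// lee_fin divr_ge0 ?powR_ge0// ltW// mulr_gt0//.
move: hn; rewrite GnE lte_fin -!EFinM lee_fin => hn.
have -> : (C * r / vol x (2 * lam * r) `^ s^-1 *
   (cemb x (2 * lam * r) * fine (nX (Gn n \_ B2))) = F * fine (nX (Gn n \_ B2)))%R.
  by rewrite /F /ball_factor; ring.
have -> : (F * b + e = F * (b + e / F))%R by field; rewrite gt_eqF.
by rewrite ler_wpM2l// ltW.
Qed.

End embeddings.

(* In the second clause the extra inclusion 2 lam B `<=` 2 lam B0 is needed: in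
   a general metric space it does not follow from B `<=` B0, and without it the
   two-sided bound on the constant fails.  It holds, for example, whenever the
   center of B is at distance at most R0 - r from that of B0. *)
Theorem proposition6p7 (R : realType) (d : measure_display)
    (T : metricMeasurableType R d) (mu : {measure set T -> \bar R})
    (nX : (T -> \bar R) -> \bar R) (p s lam : R) (cemb : T -> R -> R)
    (hmu : borel_regular_measure mu)
    (hdbl : doubling mu)
    (hX : quasi_banach_function_lattice mu nX)
    (hp : 1 <= p) (hps : p < s) (hlam : 1 <= lam)
    (hPI : poincare mu p lam)
    (hs : dimension_condition mu s)
    (hemb : embeds_Lorentz_loc mu nX s cemb) :
  exists2 C : R, 0 < C &
    forall (x0 : T) (R0 : R), 0 < R0 ->
      (exists2 c0 : R, 0 < c0 &
        forall (x : T) (r : R), 0 < r -> r < R0 -> ball x r `<=` ball x0 R0 ->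
        forall u g : T -> \bar R,
          in_N1 nX u -> in_X nX g -> weak_upper_gradient nX u g ->
          (cap_ess_sup nX (ball x r)
               (fun y => `|u y - average mu (ball x r) u|)
             <= (C * ball_factor mu s lam cemb x r)%:E
                * nX (g \_ (ball x (2 * lam * r))))%E
          /\
          ((ball_factor mu s lam cemb x r)%:E * nX (g \_ (ball x (2 * lam * r)))
             <= c0%:E * nX (g \_ (ball x (2 * lam * r))))%E)
      /\
      (exists c0 : R,
        [/\ 0 < c0,
            C^-1 * ball_factor mu s lam cemb x0 R0 <= c0,
            c0 <= C * ball_factor mu s lam cemb x0 R0
          & forall (x : T) (r : R), 0 < r -> r < R0 ->
            ball x r `<=` ball x0 R0 ->
            ball x (2 * lam * r) `<=` ball x0 (2 * lam * R0) ->
            forall u g : T -> \bar R,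
              in_N1 nX u -> in_X nX g -> weak_upper_gradient nX u g ->
              ((ball_factor mu s lam cemb x r)%:E
                 * nX (g \_ (ball x (2 * lam * r)))
                 <= c0%:E * nX (g \_ (ball x (2 * lam * r))))%E]).

Proof.
have s1 : 1 < s by exact: le_lt_trans hps.
have s0 : 0 < s by exact: lt_trans s1.
have lam0 : 0 < lam by exact: lt_le_trans hlam.
have [C1 C10 hC1] := cap_ess_sup_oscillation hmu hX s1 hemb hdbl hs hPI hp hps hlam.
have [c c0 hc] := hs.
pose e := c `^ s^-1; have e0 : 0 < e by rewrite powR_gt0.
(* [e^-1] is the factor lost in [ball_factor_le]; [C] dominates it and its inverse for the sake of
   the two-sided bound. *)
pose C := C1 + e + e^-1.
have v0 : 0 < e^-1 by rewrite invr_gt0.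
have [C0 [C1C [eC vC]]] : 0 < C /\ C1 <= C /\ e <= C /\ e^-1 <= C.
  by rewrite /C; do !split; lra.
have nX0 x r (g : T -> \bar R) : in_X nX g -> (0 <= nX (g \_ (ball x r)))%E.
  move=> Xg; apply: (qnorm_ge0 hX).
  exact: (in_X_restrict hX (measurable_metric_ball hmu x r) Xg).1.
exists C => // x0 R0 R00; split.
  (* As [mdist x0 x < R0] and [r < R0], the triangle inequality puts [ball x (2 * lam * r)] inside
     [ball x0 P]. *)
  pose P := R0 + 2 * lam * R0.
  have P0 : 0 < P by rewrite addr_gt0// !mulr_gt0.
  exists (e^-1 * (cemb x0 P * (P / (2 * lam)) / (fine (mu (ball x0 P))) `^ s^-1)).
    rewrite mulr_gt0 ?invr_gt0// divr_gt0 ?powR_gt0 ?fine_measure_ball_gt0//.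
    by rewrite mulr_gt0 ?(embedding_gt0 hemb)// divr_gt0// mulr_gt0.
  move=> x r r0 rR sub u g N1u Xg wug; split.
    apply: le_trans (hC1 x r u g r0 N1u Xg wug) _.
    rewrite lee_wpmul2r ?nX0// lee_fin.
    have bf0 := ball_factor_gt0 hmu hemb x lam0 r0.
    by rewrite ler_wpM2r ?(ltW bf0).
  rewrite lee_wpmul2r ?nX0// lee_fin.
  have xx0 : mdist x0 x < R0 by have := sub x (ballxx x r0); rewrite ballEmdist.
  have rl : 2 * lam * r <= 2 * lam * R0 by rewrite ler_wpM2l ?mulr_ge0 ?ltW.
  apply: (ball_factor_le hmu s1 hemb c0 hc lam0 r0).
  - by apply: le_trans rl _; rewrite /P lerDr ltW.
  - by rewrite ballEmdist /= (lt_trans xx0)// /P ltrDl !mulr_gt0.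
  - by apply: sub_ball; rewrite lerD// ltW.
have bf0 := ball_factor_gt0 hmu hemb x0 lam0 R00.
(* This is the bound of [ball_factor_le] for [P = 2 * lam * R0], where [P / (2 * lam)] is [R0]. *)
exists (e^-1 * ball_factor mu s lam cemb x0 R0); split.
- by rewrite mulr_gt0 ?invr_gt0.
- by rewrite ler_wpM2r ?(ltW bf0)// lef_pV2.
- by rewrite ler_wpM2r ?(ltW bf0).
move=> x r r0 rR sub sub2 u g N1u Xg wug.
rewrite lee_wpmul2r ?nX0// lee_fin.
have lR0 : 0 < 2 * lam * R0 by rewrite !mulr_gt0.
have xx0 : mdist x0 x < R0 by have := sub x (ballxx x r0); rewrite ballEmdist.
have := @ball_factor_le _ _ _ _ hmu _ _ _ s1 hemb lam c (2 * lam * R0) x x0 r c0 hc lam0 r0.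
rewrite /ball_factor (_ : 2 * lam * R0 / (2 * lam) = R0); last first.
  by field; rewrite gt_eqF.
apply => //.
- by rewrite ler_wpM2l ?mulr_ge0 ?ltW.
- rewrite ballEmdist /= (lt_le_trans xx0)// ler_peMl ?ltW//.
  by move: hlam; lra.
Qed.
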